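(* Let $M$ be a generalized Hantzsche-Wendt flat manifold of dimension $n$ with first Betti number one. Then $H_j(M,\mathbb{Q})\cong\mathbb{Q}$ if $j=0$ or $j=1$, and $H_j(M,\mathbb{Q})=0$ otherwise.
   Context: A Bieberbach group of dimension $n$ is a torsion-free, discrete, cocompact subgroup $\Gamma$ of $\mathrm{E}(n)=\mathrm{O}(n)\ltimes\mathbb{R}^n$, the group of rigid motions of $\mathbb{R}^n$. Its translation subgroup $\Lambda\cong\mathbb{Z}^n$ is normal of finite index, and $\Gamma/\Lambda$ is the holonomy group of the flat manifold $\mathbb{R}^n/\Gamma$. The flat manifold $\mathbb{R}^n/\Gamma$ is called a generalized Hantzsche-Wendt (GHW) manifold if its holonomy group is isomorphic to $\mathbb{Z}_2^{\,n-1}$. *)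

(* Defs.v *)
From HB Require Import structures.
(* [freeg] comes first because it exports a [lift] shadowing [fintype.lift]. *)
From mathcomp Require Import freeg.
From mathcomp Require Import all_boot all_order all_algebra.
From mathcomp Require Import all_classical all_reals all_analysis.

Set Implicit Arguments.
Unset Strict Implicit.
Unset Printing Implicit Defensive.

Import Order.TTheory GRing.Theory Num.Theory.
Import numFieldNormedType.Exports.

Local Open Scope classical_set_scope.
Local Open Scope quotient_scope.
Local Open Scope ring_scope.

(** * Homology of a pair of composable linear maps *)

Section Homology.
Variables (K : nzRingType) (U V W : lmodType K).
Variables (f : {linear U -> V}) (g : {linear V -> W}).

Definition ker_pred : {pred V} := [pred z | g z == 0].

Lemma ker_pred_submod : submod_closed ker_pred.
Proof.
split=> [|a x y]; rewrite !inE ?linear0 // => /eqP gx /eqP gy.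
by rewrite linearP gx gy scaler0 addr0.
Qed.

Record ker_lmod := KerLmod { ker_val : V; _ : ker_val \in ker_pred }.

HB.instance Definition _ := [isSub for ker_val].
HB.instance Definition _ := [Choice of ker_lmod by <:].
HB.instance Definition _ :=
  GRing.SubChoice_isSubLmodule.Build K V ker_pred ker_lmod ker_pred_submod.

Definition im_in_ker : {pred ker_lmod} :=
  [pred z | `[< exists x : U, f x = val z >]].

Lemma im_in_ker_submod : submod_closed im_in_ker.
Proof.
split=> [|a x y]; rewrite !inE.
  by exists 0; rewrite !linear0.
by move=> [u fu] [v fv]; exists (a *: u + v); rewrite linearP fu fv.
Qed.

HB.instance Definition _ :=
  GRing.isSubmodClosed.Build K ker_lmod im_in_ker im_in_ker_submod.

(* ker g / (im f :&: ker g), which is ker g / im f as soon as g \o f = 0. *)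
Definition homology := Quotient.quot im_in_ker.

HB.instance Definition _ := GRing.Zmodule.on homology.

Local Notation "[ x ]_H" := (\pi_(Quotient.quot im_in_ker) x : homology).

Definition homology_scale (a : K) : homology -> homology :=
  lift_op1 homology ( *:%R a).

Lemma pi_homology_scale a (x : ker_lmod) :
  [a *: x]_H = homology_scale a [x]_H.
Proof.
unlock homology_scale; apply/eqP; rewrite piE Quotient.equivE -scalerBr.
by apply: rpredZ; rewrite Quotient.idealrBE reprK.
Qed.

Let piD (x y : ker_lmod) : [x]_H + [y]_H = [x + y]_H.
Proof. by rewrite !piE. Qed.

Fact homology_scaleA a b v :
  homology_scale a (homology_scale b v) = homology_scale (a * b) v.
Proof. by rewrite -[v]reprK -!pi_homology_scale scalerA. Qed.

Fact homology_scale1 : left_id 1 homology_scale.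
Proof. by move=> v; rewrite -[v]reprK -pi_homology_scale scale1r. Qed.

Fact homology_scaleDr : right_distributive homology_scale +%R.
Proof.
move=> a u v; rewrite -[u]reprK -[v]reprK -!pi_homology_scale !piD.
by rewrite -pi_homology_scale scalerDr.
Qed.

Fact homology_scaleDl v : {morph homology_scale^~ v : a b / a + b}.
Proof. by move=> a b; rewrite -[v]reprK -!pi_homology_scale piD scalerDl. Qed.

HB.instance Definition _ := GRing.Zmodule_isLmodule.Build K homology
  homology_scaleA homology_scale1 homology_scaleDr homology_scaleDl.

End Homology.

(** * Singular homology *)

Section StandardSimplex.
Variable R : realType.

Definition simplex_set (j : nat) : set 'rV[R]_j.+1 :=
  [set x | (forall i, 0 <= x 0 i) /\ \sum_i x 0 i = 1].
Arguments simplex_set : clear implicits.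

Definition simplex (j : nat) : topologicalType := set_type (simplex_set j).

(* The affine map of R^{j+1} into R^{j+2} inserting a zero in position [i]. *)
Definition insert0 (j : nat) (i : 'I_j.+2) (x : 'rV[R]_j.+1) : 'rV[R]_j.+2 :=
  \row_k (if unlift i k is Some l then x 0 l else 0).

Lemma insert0_simplex j (i : 'I_j.+2) (x : simplex j) :
  insert0 i (set_val x) \in simplex_set j.+1.
Proof.
have [x0 x1] := set_valP x; apply/mem_set; split=> [k|].
  by rewrite mxE; case: unliftP.
rewrite (bigD1_ord i)//= mxE unlift_none add0r -[RHS]x1.
by apply: eq_bigr => k _; rewrite mxE liftK.
Qed.

Definition face_map (j : nat) (i : 'I_j.+2) (x : simplex j) : simplex j.+1 :=
  exist _ (insert0 i (set_val x)) (insert0_simplex i x).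

Lemma insert0_continuous j (i : 'I_j.+2) : continuous (@insert0 j i).
Proof.
move=> x A [P nP sPA]; exists (fun r (l : 'I_j.+1) => P r (lift i l)) => [r l|y Py].
  by have := nP r (lift i l); rewrite mxE liftK ord1.
apply: sPA => r k; rewrite mxE; case: unliftP => [l ->|->].
  by have := Py r l; rewrite ord1.
by have /nbhs_singleton := nP r i; rewrite mxE unlift_none.
Qed.

Lemma face_map_continuous j (i : 'I_j.+2) : continuous (face_map i).
Proof.
apply: continuous_comp_initial => x.
apply: (@continuous_comp (simplex j) 'rV[R]_j.+1 'rV[R]_j.+2 set_val (insert0 i)).
  exact: initial_continuous.
exact: insert0_continuous.
Qed.

HB.instance Definition _ (j : nat) (i : 'I_j.+2) :=
  isContinuous.Build (simplex j) (simplex j.+1) (face_map i)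
    (@face_map_continuous j i).

End StandardSimplex.

Section SingularHomology.
Variables (K : nzRingType) (R : realType) (X : topologicalType).

Definition singular_simplex (j : nat) := continuousType (simplex R j) X.

Definition face (j : nat) (i : 'I_j.+2) (s : singular_simplex j.+1) :
  singular_simplex j := s \o face_map i.

Definition chain (j : nat) : lmodType K := {freeg (singular_simplex j) / K}.

Definition boundary_simplex (j : nat) (s : singular_simplex j.+1) : chain j :=
  \sum_(i < j.+2) (-1) ^+ i *: << face i s >>.

Definition boundaryS (j : nat) : chain j.+1 -> chain j :=
  fglift (@boundary_simplex j).

Lemma boundaryS_linear j : linear (@boundaryS j).
Proof.
pose B : chain j.+1 -> chain j := @boundaryS j.
have BB : zmod_morphism B by exact: lift_is_additive.
have B0 : B 0 = 0 by rewrite -[0 in LHS](subrr 0) BB subrr.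
have BD x y : B (x + y) = B x + B y.
  by rewrite -[y in LHS]opprK BB -[- y]sub0r BB B0 sub0r opprK.
have Bsum (c : singular_simplex j.+1 -> K) s :
    B (\sum_(k <- s) << c k *g k >>) = \sum_(k <- s) c k *: boundary_simplex k.
  elim: s => [|k s IH]; first by rewrite !big_nil B0.
  by rewrite !big_cons BD IH; congr (_ + _); exact: liftU.
move=> a x y; rewrite -!/(B _) BD; congr (_ + _).
rewrite -[in RHS](freeg_sumE x).
rewrite -[LHS]/(B (fgscale a x)) /fgscale !Bsum scaler_sumr.
by apply: eq_bigr => k _; rewrite scalerA.
Qed.

HB.instance Definition _ j := GRing.isLinear.Build K (chain j.+1) (chain j) _
  (@boundaryS j) (@boundaryS_linear j).

(* In degree 0 the truncated predecessor makes the target [chain 0], not 0;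
   only its kernel, which is all of [chain 0], is used. *)
Definition boundary (j : nat) : {linear chain j -> chain j.-1} :=
  match j with
  | 0 => \0
  | j'.+1 => @boundaryS j'
  end.

Definition singular_homology (j : nat) : lmodType K :=
  homology (boundary j.+1) (boundary j).

End SingularHomology.

Arguments singular_homology K R X j : clear implicits.

Definition lmod_iso (K : nzRingType) (V W : lmodType K) : Prop :=
  exists f : {linear V -> W}, bijective f.

(* The j-th Betti number of X is d, i.e. dim_Q H_j(X, Q) = d. *)
Definition has_betti_number (R : realType) (X : topologicalType) (j d : nat) :
    Prop :=
  lmod_iso (singular_homology rat R X j) 'rV[rat]_d.

(** * Subgroups and quotient groups *)

Record subgroup_of (G : groupType) (H : groupClosed G) :=
  SubgroupOf { subgroup_val : G; _ : subgroup_val \in H }.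

Section SubgroupOf.
Variables (G : groupType) (H : groupClosed G).

HB.instance Definition _ := [isSub for @subgroup_val G H].
HB.instance Definition _ := [Choice of subgroup_of H by <:].

Fact subgroup_closed : group_closed (fun x => x \in H).
Proof. by split; [exact: gpred1|move=> x y; exact: gpredF]. Qed.

HB.instance Definition _ :=
  SubChoice_isSubGroup.Build G _ (subgroup_of H) subgroup_closed.

End SubgroupOf.

Section LeftCosets.
Variables (G : groupType) (H : groupClosed G).

Definition same_lcoset (x y : G) : bool := (x^-1 * y \in H)%g.

Lemma same_lcoset_equiv : equiv_class_of same_lcoset.
Proof.
split=> [x|x y|y x z]; rewrite /same_lcoset.
- by rewrite mulVg gpred1.
- by rewrite -[RHS]gpredV invgM invgK.
- by move=> xy yz; rewrite -(mulVKg y z) mulgA gpredM.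
Qed.

Canonical same_lcoset_equiv_rel := EquivRelPack same_lcoset_equiv.
Canonical same_lcoset_encModRel := defaultEncModRel same_lcoset.

Definition left_cosets := {eq_quot same_lcoset}.

HB.instance Definition _ := Choice.on left_cosets.
HB.instance Definition _ : EqQuotient G same_lcoset left_cosets :=
  EqQuotient.on left_cosets.

End LeftCosets.

HB.mixin Record isNormalClosed (G : groupType) (S : {pred G}) := {
  gpredJ_normal : forall x y : G, x \in S -> (x ^ y)%g \in S
}.

#[short(type="normalClosed")]
HB.structure Definition NormalClosed (G : groupType) :=
  {S of GroupClosed G S & isNormalClosed G S}.

Definition quotient_group (G : groupType) (H : normalClosed G) :=
  left_cosets H.

Section QuotientGroup.
Variables (G : groupType) (H : normalClosed G).
Local Notation Q := (quotient_group H).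

HB.instance Definition _ := Choice.on Q.
HB.instance Definition _ : EqQuotient G (same_lcoset H) Q :=
  EqQuotient.on Q.

Definition quotient_one : Q := lift_cst Q 1%g.
Definition quotient_inv : Q -> Q := lift_op1 Q (fun x : G => x^-1)%g.
Definition quotient_mul : Q -> Q -> Q := lift_op2 Q *%g.

Lemma eq_quotientE (x y : G) : (x == y %[mod Q]) = (x^-1 * y \in H)%g.
Proof. by rewrite piE. Qed.

Lemma repr_quotient (x : G) : (x^-1 * repr (\pi_Q x : Q) \in H)%g.
Proof. by rewrite -eq_quotientE reprK. Qed.

Lemma pi_quotient_inv : {morph \pi_Q : x / (x^-1)%g >-> quotient_inv x}.
Proof.
move=> x; unlock quotient_inv; apply/eqP; rewrite eq_quotientE invgK.
have := repr_quotient x; set y := repr _ => xy.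
have -> : (x * y^-1 = ((x^-1 * y)^-1) ^ y^-1)%g.
  by rewrite invgM invgK conjgE invgK -mulgA mulVKg.
by apply: gpredJ_normal; rewrite gpredV.
Qed.

Lemma pi_quotient_mul : {morph \pi_Q : x y / (x * y)%g >-> quotient_mul x y}.
Proof.
move=> x y; unlock quotient_mul; apply/eqP; rewrite eq_quotientE.
have := repr_quotient x; set x' := repr _ => xx'.
have := repr_quotient y; set y' := repr _ => yy'.
have -> : ((x * y)^-1 * (x' * y') = (x^-1 * x') ^ y * (y^-1 * y'))%g.
  by rewrite invgM conjgE !mulgA mulgK.
by apply: gpredM => //; exact: gpredJ_normal.
Qed.

Canonical pi_quotient_one_morph := PiConst quotient_one.
Canonical pi_quotient_inv_morph := PiMorph1 pi_quotient_inv.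
Canonical pi_quotient_mul_morph := PiMorph2 pi_quotient_mul.

Fact quotient_mulA : associative quotient_mul.
Proof. by move=> x y z; rewrite -[x]reprK -[y]reprK -[z]reprK !piE mulgA. Qed.

Fact quotient_mul1 : left_id quotient_one quotient_mul.
Proof. by move=> x; rewrite -[x]reprK !piE mul1g. Qed.

Fact quotient_mulg1 : right_id quotient_one quotient_mul.
Proof. by move=> x; rewrite -[x]reprK !piE mulg1. Qed.

Fact quotient_mulV : left_inverse quotient_one quotient_inv quotient_mul.
Proof. by move=> x; rewrite -[x]reprK !piE mulVg. Qed.

Fact quotient_mulgV : right_inverse quotient_one quotient_inv quotient_mul.
Proof. by move=> x; rewrite -[x]reprK !piE mulgV. Qed.

HB.instance Definition _ := isGroup.Build Q
  quotient_mulA quotient_mul1 quotient_mulg1 quotient_mulV quotient_mulgV.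

End QuotientGroup.

(** * Rigid motions of R^n *)

(* The pair (A, a) stands for the motion x |-> A x + a. *)
Record motion (R : realType) (n : nat) := Motion {
  motion_pair : 'M[R]_n * 'cV[R]_n;
  _ : motion_pair.1^T *m motion_pair.1 == 1%:M
}.

Section Motion.
Variables (R : realType) (n : nat).
Local Notation E := (motion R n).

HB.instance Definition _ := [isSub for @motion_pair R n].
HB.instance Definition _ := [Choice of E by <:].
HB.instance Definition _ :=
  Topological.copy E (initial_topology (@motion_pair R n)).

Definition linear_part (g : E) : 'M[R]_n := (motion_pair g).1.
Definition translation_part (g : E) : 'cV[R]_n := (motion_pair g).2.

Definition act (g : E) (x : 'cV[R]_n) : 'cV[R]_n :=
  linear_part g *m x + translation_part g.

Lemma linear_part_orthogonal (g : E) :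
  (linear_part g)^T *m linear_part g = 1%:M.
Proof. by case: g => p p_orth; apply/eqP. Qed.

Lemma linear_part_orthogonalC (g : E) :
  linear_part g *m (linear_part g)^T = 1%:M.
Proof. exact/mulmx1C/linear_part_orthogonal. Qed.

Lemma motion_eq (g h : E) : linear_part g = linear_part h ->
  translation_part g = translation_part h -> g = h.
Proof.
move=> e1 e2; apply: val_inj; rewrite [LHS]surjective_pairing.
by rewrite [RHS]surjective_pairing; congr pair.
Qed.

Fact motion_one_subproof : (1%:M : 'M[R]_n)^T *m 1%:M == 1%:M.
Proof. by rewrite trmx1 mulmx1. Qed.

Definition motion_one : E := Motion (motion_pair := (1%:M, 0)) motion_one_subproof.

Fact motion_mul_subproof (g h : E) :
  (linear_part g *m linear_part h)^T *m (linear_part g *m linear_part h) == 1%:M.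
Proof.
rewrite trmx_mul mulmxA -(mulmxA _ _ (linear_part g)).
by rewrite linear_part_orthogonal mulmx1 linear_part_orthogonal.
Qed.

Definition motion_mul (g h : E) : E :=
  Motion (motion_pair := (linear_part g *m linear_part h,
    linear_part g *m translation_part h + translation_part g))
    (motion_mul_subproof g h).

Fact motion_inv_subproof (g : E) :
  (linear_part g)^T^T *m (linear_part g)^T == 1%:M.
Proof. by rewrite trmxK linear_part_orthogonalC. Qed.

Definition motion_inv (g : E) : E :=
  Motion (motion_pair := ((linear_part g)^T,
    - ((linear_part g)^T *m translation_part g))) (motion_inv_subproof g).

Fact motion_mulA : associative motion_mul.
Proof.
move=> g h k; apply: motion_eq; rewrite /linear_part /translation_part /=.
  by rewrite mulmxA.
by rewrite mulmxDr mulmxA addrA.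
Qed.

Fact motion_mul1 : left_id motion_one motion_mul.
Proof.
move=> g; apply: motion_eq; rewrite /linear_part /translation_part /=.
  by rewrite mul1mx.
by rewrite mul1mx addr0.
Qed.

Fact motion_mulg1 : right_id motion_one motion_mul.
Proof.
move=> g; apply: motion_eq; rewrite /linear_part /translation_part /=.
  by rewrite mulmx1.
by rewrite mulmx0 add0r.
Qed.

Fact motion_mulV : left_inverse motion_one motion_inv motion_mul.
Proof.
move=> g; apply: motion_eq; last exact: subrr.
exact: linear_part_orthogonal.
Qed.

Fact motion_mulgV : right_inverse motion_one motion_inv motion_mul.
Proof.
move=> g; apply: motion_eq; first exact: linear_part_orthogonalC.
rewrite [LHS](_ : _ = linear_part g *m
  - ((linear_part g)^T *m translation_part g) + translation_part g) //.
by rewrite mulmxN mulmxA linear_part_orthogonalC mul1mx addNr.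
Qed.

HB.instance Definition _ := isGroup.Build E
  motion_mulA motion_mul1 motion_mulg1 motion_mulV motion_mulgV.

Lemma linear_partM g h :
  linear_part (g * h)%g = linear_part g *m linear_part h.
Proof. by []. Qed.

Lemma linear_partV g : linear_part (g^-1)%g = (linear_part g)^T.
Proof. by []. Qed.

Lemma act1 x : act 1%g x = x.
Proof. by rewrite /act mul1mx addr0. Qed.

Lemma actM g h x : act (g * h)%g x = act g (act h x).
Proof. by rewrite /act /= mulmxDr mulmxA addrA. Qed.

End Motion.

(** * Bieberbach groups and flat manifolds *)

Section Bieberbach.
Variables (R : realType) (n : nat) (Gamma : groupClosed (motion R n)).

Definition torsion_free : Prop :=
  forall (g : motion R n) (k : nat),
    g \in Gamma -> (0 < k)%N -> (g ^+ k = 1)%g -> g = 1%g.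

(* The topology induced by E(n) on [Gamma] is discrete. *)
Definition discrete_subgroup : Prop :=
  forall A : set (initial_topology (@subgroup_val _ Gamma)), open A.

(* The coset space E(n)/Gamma is compact. *)
Definition cocompact : Prop :=
  compact [set: quotient_topology (left_cosets Gamma)].

Definition bieberbach : Prop :=
  [/\ torsion_free, discrete_subgroup & cocompact].

Definition same_orbit (x y : 'cV[R]_n) : bool :=
  `[< exists2 g, g \in Gamma & act g x = y >].

Lemma same_orbit_equiv : equiv_class_of same_orbit.
Proof.
have sym x y : same_orbit x y -> same_orbit y x.
  move=> /asboolP[g gG <-]; apply/asboolP; exists (g^-1)%g.
    by rewrite gpredV.
  by rewrite -actM mulVg act1.
split=> [x|x y|y x z].
- by apply/asboolP; exists 1%g; rewrite ?gpred1 ?act1.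
- by apply/idP/idP; exact: sym.
- move=> /asboolP[g gG <-] /asboolP[h hG <-]; apply/asboolP.
  by exists (h * g)%g; rewrite ?gpredM ?actM.
Qed.

Canonical same_orbit_equiv_rel := EquivRelPack same_orbit_equiv.
Canonical same_orbit_encModRel := defaultEncModRel same_orbit.

(* The orbit space of [Gamma], which is a flat manifold if [Gamma] is a
   Bieberbach group. *)
Definition orbit_space : topologicalType :=
  quotient_topology {eq_quot same_orbit}.

(* The translation subgroup, as a subgroup of the group [Gamma]. *)
Definition translations : {pred subgroup_of Gamma} :=
  [pred g | linear_part (val g) == 1%:M].

Fact translations_group : group_closed translations.
Proof.
split=> [|g h]; rewrite !inE //= => /eqP g1 /eqP h1.
by rewrite linear_partM linear_partV g1 h1 trmx1 mulmx1.
Qed.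

Fact translations_normal (g h : subgroup_of Gamma) :
  g \in translations -> (g ^ h)%g \in translations.
Proof.
rewrite !inE => /eqP g1; rewrite /conjg !valM !linear_partM linear_partV.
by rewrite g1 mul1mx linear_part_orthogonal.
Qed.

HB.instance Definition _ := isMulClosed.Build _ translations
  (group_closedM translations_group).
HB.instance Definition _ := isMul1Closed.Build _ translations
  (fst translations_group).
HB.instance Definition _ := isInvClosed.Build _ translations
  (group_closedV translations_group).
HB.instance Definition _ := isNormalClosed.Build _ translations
  translations_normal.

Definition holonomy_group : groupType := quotient_group translations.

(* The condition n > 0 gives a meaning to the exponent n - 1.
   'rV['F_2]_(n - 1) with its addition is the group Z_2^(n - 1). *)
Definition generalized_hantzsche_wendt : Prop :=
  [/\ (0 < n)%N, bieberbach &
      exists f : holonomy_group -> 'rV['F_2]_n.-1,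
        bijective f /\ forall x y, f (x * y)%g = f x + f y].

End Bieberbach.

(* Main.v *)
Require Import Defs.
From HB Require Import structures.
From mathcomp Require Import freeg.
From mathcomp Require Import all_boot all_order all_algebra.
From mathcomp Require Import all_classical all_reals all_analysis.
From mathcomp Require Import zify ring lra.
Set Implicit Arguments.
Unset Strict Implicit.
Unset Printing Implicit Defensive.
Import Order.TTheory GRing.Theory Num.Theory.
Import numFieldNormedType.Exports.
Local Open Scope classical_set_scope.
Local Open Scope quotient_scope.
Local Open Scope ring_scope.

(** Let [Gamma] be a Bieberbach group of dimension n with holonomy
    [Z_2^(n-1)].

    Shape of the group.  The holonomy is an abelian group of commuting
    involutions, so that some vectors of the translation lattice, common
    eigenvectors of the holonomy, form a basis of R^n
    ([eigen_lattice_functional_eq0], [basis_from_spanning]).  In the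
    coordinates of this basis, [Gamma] contains Z^n with finite index and acts
    by the maps y |-> D y + b with D a diagonal matrix of signs.  The matrices
    D form a group of 2^(n-1) sign vectors, an index two subgroup of {1,-1}^n.

    Rational homology.  By transfer, a cycle of R^n/[Gamma] bounds as soon as
    the average of its lifts bounds in the torus T = R^n/Z^n
    ([boundary_of_null]), and this average is a cycle of T whose class is
    invariant under every D.  So it is enough to find the classes of T which
    are invariant under the sign group.

    Classes of the torus.  Write r_k for the reflection of the k-th coordinate
    and p_k for the projection forgetting it.  The Kuenneth formula splits
    H(T) into the image of p_k and a complement on which r_k is -1; in other
    words 1 + r_k = 2 p_k ([flip_kill]).  A class fixed by r_k is therefore
    fixed by p_k, i.e. comes from the subtorus of the other coordinates.  In
    degree one, moreover, (1 - p_k)(1 - p_l) = 0 for distinct k and l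
    ([null_kill_kill1]).

    Conclusion.  An index two subgroup S of {1,-1}^n satisfies one of the
    following ([sign_group_dichotomy]).
    - S contains all the reflections r_k, except perhaps r_i.  An invariant
      class then comes from the i-th coordinate circle, hence vanishes in
      degree at least two ([null_of_flips]).
    - S lacks two reflections, and then, having index two, it contains the
      product of any two reflections that it lacks.  The relations above then
      show that an invariant class of degree one is fixed by every p_k, hence
      zero ([null1_of_flips]): the first Betti number is zero, contrary to the
      hypothesis.
    In degree zero, R^n/[Gamma] is path-connected.

    The computation is done on singular chains of R^n.  The chains of
    R^n/Z^K, for a set K of coordinates, are the coinvariants of the chains of
    R^n under Z^K, so a cycle of R^n/Z^K is a chain whose boundary lies in the
    span [lattice_zero K] of the t_k c - c, with t_k the translation by the
    k-th basis vector and k in K.  One adds the coordinates to K one at a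
    time: if z is a cycle modulo K + k, its boundary is t_k y - y modulo K for
    a cycle y modulo K, because t_k - 1 is injective on the coinvariants of K
    ([lattice_zero_regular]).  This y plays the role of the component of z
    along the k-th circle in the Gysin sequence of R^n/Z^K -> R^n/Z^(K+k). *)

(** * Linear maps on free modules and on chains *)

Section FreeExtension.
Variables (K : nzRingType) (T : choiceType).

Definition fgen (x : T) : {freeg T / K} := << x >>.

Lemma coeff_fgen x y : coeff y (fgen x) = (x == y)%:R.
Proof. by rewrite coeffU mul1r. Qed.

Lemma freeg_ind_lin (P : {freeg T / K} -> Prop) : P 0 ->
  (forall a x D, P D -> P (a *: fgen x + D)) -> forall D, P D.
Proof.
move=> P0 PS; elim/freeg_ind_dom0 => // k x D _ _ PD.
rewrite (_ : << k *g x >> = k *: fgen x); first exact: PS.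
by apply/eqP/freeg_eqP => y; rewrite coeffZ !coeffU mul1r.
Qed.

Section Ext.
Variables (V : lmodType K) (f : T -> V).

Definition free_ext : {freeg T / K} -> V := fglift f.

Lemma free_ext_linear : linear free_ext.
Proof.
have BB : zmod_morphism free_ext by exact: lift_is_additive.
have B0 : free_ext 0 = 0 by rewrite -[0 in LHS](subrr 0) BB subrr.
have BD x y : free_ext (x + y) = free_ext x + free_ext y.
  by rewrite -[y in LHS]opprK BB -[- y]sub0r BB B0 sub0r opprK.
have BU c x : free_ext << c *g x >> = c *: f x by exact: liftU.
have BZ a x : free_ext (a *: fgen x) = a *: f x.
  rewrite -BU; congr free_ext.
  by apply/eqP/freeg_eqP => y; rewrite coeffZ !coeffU mul1r.
move=> a x y; rewrite BD; congr (_ + _).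
elim/freeg_ind_lin: x => [|b x D IH]; first by rewrite !(scaler0, B0).
by rewrite scalerDr !BD IH scalerA !BZ scalerDr scalerA.
Qed.

HB.instance Definition _ := GRing.isLinear.Build K {freeg T / K} V _
  free_ext free_ext_linear.

Lemma free_extU x : free_ext (fgen x) = f x.
Proof. by rewrite /free_ext liftU scale1r. Qed.

End Ext.

Lemma linear_freeg_eq (V : lmodType K) (f g : {linear {freeg T / K} -> V}) :
  (forall x, f (fgen x) = g (fgen x)) -> f =1 g.
Proof.
move=> fg; elim/freeg_ind_lin => [|a x D IH]; first by rewrite !linear0.
by rewrite !linearP fg IH.
Qed.

End FreeExtension.
Arguments fgen {K T} x.

Section Push.
Variables (K : nzRingType) (R : realType).
Implicit Types X Y Z : topologicalType.

(** The type of the generator fixes the module structure of chains, so that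
    rewriting with the linearity lemmas does not meet two presentations of the
    same structure. *)
Definition gen X j (s : singular_simplex R X j) : chain K R X j := fgen s.
Arguments gen {X j} s.

Lemma linear_chain_eq X j (V : lmodType K) (f g : {linear chain K R X j -> V}) :
  (forall s, f (gen s) = g (gen s)) -> f =1 g.
Proof. exact: linear_freeg_eq. Qed.

Lemma chain_ind X j (P : chain K R X j -> Prop) : P 0 ->
  (forall a s c, P c -> P (a *: gen s + c)) -> forall c, P c.
Proof. exact: freeg_ind_lin. Qed.

Definition chain_ext X j (V : lmodType K) (f : singular_simplex R X j -> V) :
  {linear chain K R X j -> V} := free_ext f.

Lemma chain_extU X j (V : lmodType K) (f : singular_simplex R X j -> V) s :
  chain_ext f (gen s) = f s.
Proof. exact: free_extU. Qed.

Definition push_simplex X Y (f : continuousType X Y) j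
  (s : singular_simplex R X j) : singular_simplex R Y j := f \o s.

Definition push X Y (f : continuousType X Y) j :
    {linear chain K R X j -> chain K R Y j} :=
  chain_ext (fun s => gen (push_simplex f s)).
Arguments push {X Y} f {j}.

Lemma pushU X Y (f : continuousType X Y) j (s : singular_simplex R X j) :
  push f (gen s) = gen (push_simplex f s).
Proof. exact: chain_extU. Qed.

Lemma push_comp X Y Z (f : continuousType X Y) (g : continuousType Y Z)
  (h : continuousType X Z) j (c : chain K R X j) : h =1 g \o f ->
  push g (push f c) = push h c.
Proof.
move=> hE; rewrite -[LHS]/((push g \o push f) c).
apply: linear_chain_eq => s /=; rewrite !pushU; congr gen.
by apply/continuousEP => x; rewrite /= hE.
Qed.

Lemma push_id X (f : continuousType X X) j (c : chain K R X j) :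
  f =1 id -> push f c = c.
Proof.
move=> fE; rewrite -[RHS]/(idfun c); apply: linear_chain_eq => s /=.
by rewrite pushU; congr gen; apply/continuousEP => x; rewrite /= fE.
Qed.

Lemma eq_push X Y (f g : continuousType X Y) j (c : chain K R X j) :
  f =1 g -> push f c = push g c.
Proof. by move=> fg; have /continuousEP-> : f =1 g. Qed.

Lemma boundaryU X j (s : singular_simplex R X j.+1) :
  boundary K R X j.+1 (gen s) = \sum_(i < j.+2) (-1) ^+ i *: gen (face i s).
Proof. exact: (free_extU (@boundary_simplex K R X j)). Qed.

Lemma boundary_push X Y (f : continuousType X Y) j (c : chain K R X j) :
  boundary K R Y j (push f c) = push f (boundary K R X j c).
Proof.
case: j c => [|j] c; first by rewrite /= linear0.
rewrite -[LHS]/((boundary K R Y j.+1 \o push f) c).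
rewrite -[RHS]/((push f \o boundary K R X j.+1) c).
apply: linear_chain_eq => s.
rewrite -[LHS]/(boundary K R Y j.+1 (push f (gen s))).
rewrite -[RHS]/(push f (boundary K R X j.+1 (gen s))).
rewrite !pushU !boundaryU linear_sum; apply: eq_bigr => i _.
rewrite linearZ pushU; congr (_ *: gen _).
exact/continuousEP.
Qed.

End Push.
Arguments gen {K R X j} s.
Arguments push {K R X Y} f {j}.
Arguments chain_ext {K R X j V} f.

(** * The boundary of a boundary is zero *)

Section BoundaryBoundary.
Variables (K : nzRingType) (R : realType) (X : topologicalType).

Lemma face_map_comp j (i k : nat) (x : simplex R j) : (k < i < j.+3)%N ->
  face_map (inord i : 'I_j.+3) (face_map (inord k : 'I_j.+2) x) =
  face_map (inord k : 'I_j.+3) (face_map (inord i.-1 : 'I_j.+2) x).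
Proof.
move=> /andP[ki ij].
have unliftE m (a b : 'I_m.+1) (c : 'I_m) :
    b = bump a c :> nat -> unlift a b = Some c.
  by move=> bE; rewrite (_ : b = lift a c) ?liftK//; apply: val_inj.
have vi : (inord i : 'I_j.+3) = i :> nat := inordK ij.
have vk : (inord k : 'I_j.+2) = k :> nat by apply: inordK; lia.
have vk' : (inord k : 'I_j.+3) = k :> nat by apply: inordK; lia.
have vi' : (inord i.-1 : 'I_j.+2) = i.-1 :> nat by apply: inordK; lia.
apply: val_inj; apply/rowP => l; rewrite !mxE.
case: unliftP => [l1 ->|->]; last first.
  rewrite (unliftE _ _ _ (inord i.-1 : 'I_j.+2)) ?mxE ?unlift_none//.
  by rewrite vi vk' vi' /bump; lia.
rewrite mxE; case: unliftP => [l2 ->|->]; last first.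
  rewrite (_ : lift _ _ = inord k) ?unlift_none//; apply: val_inj => /=.
  by rewrite vi vk vk' /bump; lia.
rewrite (unliftE _ _ _ (lift (inord i.-1 : 'I_j.+2) l2)); last first.
  by rewrite /= vi vk vk' vi' /bump; lia.
by rewrite mxE liftK.
Qed.

(** The simplicial identity pairs each term with [k < i] with the term of
    opposite sign obtained from (i, k) |-> (k, i - 1), and this exhausts the
    terms with [k >= i]. *)
Lemma alternating_double_sum (V : lmodType K) (G : nat -> nat -> V) m :
  (forall i k, (k < i <= m)%N -> G i k = G k i.-1) ->
  \sum_(0 <= i < m.+1) \sum_(0 <= k < m) (-1) ^+ (i + k) *: G i k = 0.
Proof.
move=> GE.
rewrite (eq_bigr (fun i =>
    \sum_(0 <= k < m | (k < i)%N) (-1) ^+ (i + k) *: G i k +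
    \sum_(0 <= k < m | ~~ (k < i)%N) (-1) ^+ (i + k) *: G i k)); last first.
  by move=> i _; rewrite (bigID (fun k => (k < i)%N)).
rewrite big_split /= addrC; apply/eqP; rewrite addr_eq0; apply/eqP.
rewrite big_nat_recr//= [X in _ + X]big_nat_cond.
rewrite [X in _ + X]big_pred0 ?addr0; last first.
  by move=> k; lia.
rewrite [in RHS](eq_bigr (fun i => \sum_(0 <= k < m)
    if (k < i)%N then (-1) ^+ (i + k) *: G i k else 0)); last first.
  by move=> i _; rewrite big_mkcond.
rewrite exchange_big /= -sumrN; apply: eq_big_nat => k /andP[_ km].
rewrite big_nat_recl//= add0r -sumrN big_mkcond /=; apply: eq_big_nat => i im.
rewrite ltnS -leqNgt; case: ifP => ki; last by rewrite oppr0.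
by rewrite [G i.+1 k]GE//= ?addSn ?exprS ?mulN1r ?scaleNr ?opprK ?(addnC i)//; lia.
Qed.

Lemma boundary_boundary j (c : chain K R X j.+1) :
  boundary K R X j (boundary K R X j.+1 c) = 0.
Proof.
case: j c => [//|j] c.
rewrite -[LHS]/((boundary K R X j.+1 \o boundary K R X j.+2) c).
rewrite -[RHS]/((\0 : {linear _ -> _}) c).
apply: linear_chain_eq => s.
rewrite -[LHS]/(boundary K R X j.+1 (boundary K R X j.+2 (gen s))) [RHS]/=.
rewrite boundaryU linear_sum /=.
pose G i k : chain K R X j :=
  gen (face (inord k : 'I_j.+2) (face (inord i : 'I_j.+3) s)).
rewrite -[RHS](@alternating_double_sum _ G j.+2); last first.
  move=> i k ik; congr gen; apply/continuousEP => x.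
  by rewrite /= face_map_comp.
rewrite big_mkord; apply: eq_bigr => i _.
rewrite linearZ boundaryU [LHS]scaler_sumr big_mkord.
by apply: eq_bigr => k _; rewrite scalerA -exprD /G !inord_val.
Qed.

End BoundaryBoundary.

(** * Topology of the standard simplex *)

Section MatrixNorm.
Variables (R : realType) (m n : nat).
Implicit Type A : 'M[R]_(m, n).

Lemma mx_norm_ltP A (e : R) : 0 < e ->
  (`|A| < e) <-> (forall i j, `|A i j| < e).
Proof.
move=> e0; rewrite {1}/Num.Def.normr /= mx_normrE; split=> [/bigmax_ltP[_ H] i j|H].
  exact: (H (i, j)).
by apply/bigmax_ltP; split=> // -[i j] _; exact: H.
Qed.

Lemma mx_norm_leP A (e : R) : 0 <= e ->
  (`|A| <= e) <-> (forall i j, `|A i j| <= e).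
Proof.
move=> e0; rewrite {1}/Num.Def.normr /= mx_normrE; split=> [/bigmax_leP[_ H] i j|H].
  exact: (H (i, j)).
by apply/bigmax_leP; split=> // -[i j] _; exact: H.
Qed.

Lemma mx_entry_le A i j : `|A i j| <= `|A|.
Proof. exact: ((mx_norm_leP A (normr_ge0 _)).1 (lexx _)). Qed.

Lemma cvg_mx T (F : set_system T) (f : T -> 'M[R]_(m, n)) A : Filter F ->
  (forall i j, f t i j @[t --> F] --> A i j) -> f @ F --> A.
Proof.
move=> FF H B [P nP sPB].
suff : \forall t \near F, forall ij, P ij.1 ij.2 (f t ij.1 ij.2).
  by apply: filterS => t Pt; apply: sPB => i j; exact: (Pt (i, j)).
by apply: filter_forall => -[i j]; apply: H; exact: nP.
Qed.

End MatrixNorm.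

Section SimplexTopology.
Variables (R : realType) (j : nat).
Local Notation D := (simplex R j).

(** Barycentric coordinates: [set_val], with a type that unification of matrix
    entries can rely on. *)
Definition bary (x : D) : 'rV[R]_j.+1 := set_val x.

Lemma baryP (x : D) : @simplex_set R j (bary x).
Proof. exact: set_valP. Qed.

Lemma nbhs_simplexP (x : D) (A : set D) : nbhs x A <->
  exists2 e : R, 0 < e & forall y : D, `|bary x - bary y| < e -> A y.
Proof.
split=> [[B [[W oW <-] Wx] BA]|[e e0 H]].
  have /nbhs_ballP[e e0 He] : nbhs (bary x) W.
    exact: open_nbhs_nbhs.
  rewrite -ball_normE in He.
  by exists e => // y xy; apply: BA; exact: He.
have xe : nbhs (bary x) [set y : 'rV[R]_j.+1 | `|bary x - y| < e].
  by apply/nbhs_ballP; exists e => //= y; rewrite -ball_normE.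
have : nbhs x (set_val @^-1` [set y : 'rV[R]_j.+1 | `|bary x - y| < e]).
  exact: (@initial_continuous D _ set_val).
by apply: filterS => y; exact: H.
Qed.

Lemma simplex_compact : compact [set: D].
Proof.
have cS : compact (@simplex_set R j).
  apply: bounded_closed_compact.
    exists 1; split => // M M1 x [x0 x1].
    have M0 : 0 <= M by apply/ltW/(lt_trans _ M1).
    apply/mx_norm_leP => // i k; rewrite ord1 ger0_norm//.
    rewrite (le_trans _ (ltW M1))// -x1 (bigD1 k)//= lerDl.
    by apply: sumr_ge0.
  have -> : @simplex_set R j =
      (\bigcap_(i in [set: 'I_j.+1])
         (fun x : 'rV[R]_j.+1 => x 0 i) @^-1` [set t | 0 <= t]) `&`
      (fun x : 'rV[R]_j.+1 => \sum_i x 0 i) @^-1` [set 1].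
    apply/seteqP; split => x [xA xB]; split => // i; last exact: (xA i).
    by move=> _; exact: (xA i).
  apply: closedI.
    apply: closed_bigI => i _; apply: preimage_closed; last exact: closed_ge.
    by move=> ? _; exact: coord_continuous.
  apply: preimage_closed; last exact: closed_eq.
  suff sum_continuous (s : seq 'I_j.+1) :
      continuous (fun x : 'rV[R]_j.+1 => \sum_(i <- s) x 0 i).
    by move=> ? _; exact: sum_continuous.
  elim: s => [|i s IH] x.
    have -> : (fun y : 'rV[R]_j.+1 => \sum_(i <- [::]) y 0 i) = cst 0.
      by apply/funext => y; rewrite big_nil.
    exact: cst_continuous.
  have -> : (fun y : 'rV[R]_j.+1 => \sum_(k <- i :: s) y 0 k) =
      (fun y : 'rV[R]_j.+1 => y 0 i + \sum_(i <- s) y 0 i).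
    by apply/funext => y; rewrite big_cons.
  by apply: continuousD; [exact: coord_continuous|exact: IH].
move=> F FF _.
have [|p [Sp cp]] := cS (set_val @ F) _.
  by apply: (@filterS _ F _ setT) filterT => x _; exact: baryP.
exists (exist _ p (mem_set Sp)); split => // A B FA.
move=> /nbhs_simplexP[e e0 eB].
have FvA : (set_val @ F) (set_val @` A).
  by apply: (@filterS _ F _ A) FA => x Ax; exists x.
have npe : nbhs p [set y : 'rV[R]_j.+1 | `|p - y| < e].
  by apply/nbhs_ballP; exists e => //= y; rewrite -ball_normE.
have [q [[x Ax xq] pq]] := cp _ _ FvA npe.
by exists x; split=> //; apply: eB; rewrite [bary x]xq.
Qed.

Lemma bary_continuous : continuous bary.
Proof. exact: initial_continuous. Qed.

Lemma bary_inj : injective bary.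
Proof. exact: val_inj. Qed.

Lemma bary_coord_continuous i : continuous (fun x => bary x 0 i).
Proof.
move=> x; apply: (@continuous_comp D 'rV[R]_j.+1 R bary (fun y => y 0 i)).
  exact: bary_continuous.
exact: coord_continuous.
Qed.

End SimplexTopology.

(** * Cones in a normed space *)

Section ContinuousAlgebra.
Variables (R : realType) (T : topologicalType).

Lemma continuous_div1B (f g : T -> R) x : g x != 1 -> {for x, continuous f} ->
  {for x, continuous g} -> {for x, continuous (fun y => f y / (1 - g y))}.
Proof.
move=> gx1 cf cg; apply: cvgM; first exact: cf.
apply: cvgV; first by rewrite subr_eq0 eq_sym.
by apply: cvgB; [exact: cvg_cst|exact: cg].
Qed.

Lemma continuous_combination (V : normedModType R) (a : V) (g : T -> R)
    (f : T -> V) x :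
  {for x, continuous g} -> {for x, continuous f} ->
  {for x, continuous (fun y => g y *: a + (1 - g y) *: f y)}.
Proof.
move=> cg cf; apply: cvgD; first by apply: cvgZr_tmp; exact: cg.
by apply: cvgZ; [apply: cvgB; [exact: cvg_cst|exact: cg]|exact: cf].
Qed.

Lemma continuous_at_normP (V : normedModType R) (f : T -> V) x :
  {for x, continuous f} <->
  forall e : R, 0 < e -> \forall y \near x, `|f x - f y| < e.
Proof. exact: cvgrPdist_lt. Qed.

End ContinuousAlgebra.

Section Cone.
Variables (K : nzRingType) (R : realType) (V : normedModType R).

Definition vertex0_row j : 'rV[R]_j.+1 := \row_k (k == ord0)%:R.

Lemma vertex0_in j : vertex0_row j \in @simplex_set R j.
Proof.
apply/mem_set; split=> [i|]; first by rewrite mxE ler0n.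
rewrite (bigD1 ord0)//= mxE eqxx big1 ?addr0// => i /negbTE i0.
by rewrite mxE i0.
Qed.

Definition vertex0 j : simplex R j := exist _ (vertex0_row j) (vertex0_in j).

(** The barycentric coordinates of the projection from vertex 0 onto the face
    opposite to it.  The formula divides by zero at vertex 0; the value chosen
    there is immaterial, since the cone multiplies it by zero. *)
Definition tail_row j (x : 'rV[R]_j.+2) : 'rV[R]_j.+1 :=
  if x 0 ord0 == 1 then vertex0_row j
  else \row_k (x 0 (lift ord0 k) / (1 - x 0 ord0)).

Lemma simplex_le1 j (x : simplex R j) i : (bary x) 0 i <= 1.
Proof.
have [x0 x1] := baryP x.
by rewrite -[X in _ <= X]x1 (bigD1 i)//= lerDl sumr_ge0.
Qed.

Lemma tail_in j (x : simplex R j.+1) : tail_row (bary x) \in @simplex_set R j.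
Proof.
have [x0 x1] := baryP x; rewrite /tail_row; case: eqP => [_|/eqP xN1].
  exact: vertex0_in.
apply/mem_set; split=> [i|].
  by rewrite mxE divr_ge0// subr_ge0 simplex_le1.
under eq_bigr do rewrite mxE.
rewrite -mulr_suml; set y := bary x in x1 xN1 *.
have <- : \sum_i y 0 (lift ord0 i) = 1 - y 0 ord0.
  by apply/eqP; rewrite eq_sym subr_eq addrC -x1 big_ord_recl.
rewrite divff//; apply: contra_neq xN1 => S0.
by rewrite -x1 big_ord_recl S0 addr0.
Qed.

Definition tail j (x : simplex R j.+1) : simplex R j :=
  exist _ (tail_row (bary x)) (tail_in x).

Lemma bary_tail j (x : simplex R j.+1) : bary (tail x) = tail_row (bary x).
Proof. by []. Qed.

Lemma bary_face j (i : 'I_j.+2) (x : simplex R j) :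
  bary (face_map i x) = insert0 i (bary x).
Proof. by []. Qed.

Lemma tail_cvg j (x : simplex R j.+1) : (bary x) 0 ord0 != 1 ->
  {for x, continuous (@tail j)}.
Proof.
move=> xN1; move=> A /nbhs_simplexP[e e0 eA].
suff : \forall y \near x,
    `|(tail_row (bary x) - tail_row (bary y) : 'rV[R]_j.+1)| < e.
  move=> H; apply: (@filterS _ (nbhs x) _ _ _ _ H) => y Hy.
  by apply: eA; exact: Hy.
have cx i := @bary_coord_continuous R j.+1 i x.
have yN1 : \forall y \near x, (bary y) 0 ord0 != 1.
  apply: (cx ord0 [set t | t != 1]); apply: open_nbhs_nbhs; split=> //.
suff H : forall i, \forall y \near x,
    `|(tail_row (bary x) - tail_row (bary y) : 'rV[R]_j.+1) 0 i| < e.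
  apply: filterS (filter_forall _ H) => y Hy.
  by apply/mx_norm_ltP => // r i; rewrite ord1.
move=> i; have : (fun y : simplex R j.+1 => (bary y) 0 (lift ord0 i) /
   (1 - (bary y) 0 ord0)) @ x -->
   (bary x) 0 (lift ord0 i) / (1 - (bary x) 0 ord0).
  by apply: continuous_div1B => //; exact: cx.
move=> /cvgrPdist_lt/(_ _ e0); apply: filterS2 yN1 => y yN1.
by rewrite /tail_row (negbTE xN1) (negbTE yN1) !mxE.
Qed.

Section ConeSimplex.
Variables (a : V) (j : nat) (s : singular_simplex R V j).

(** The join of the constant [a] at vertex 0 with [s] on the opposite face. *)
Definition cone_fun (x : simplex R j.+1) : V :=
  (bary x) 0 ord0 *: a +
  (1 - (bary x) 0 ord0) *: s (tail x).

Lemma singular_simplex_bounded : exists2 M : R, 0 < M & forall x, `|s x| <= M.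
Proof.
have /compact_bounded[M [_ HM]] : compact (s @` [set: simplex R j]).
  apply: continuous_compact; last exact: simplex_compact.
  by apply: continuous_subspaceT => x; exact: cts_fun.
exists (`|M| + 1); first by rewrite ltr_wpDl.
by move=> x; apply: HM; [rewrite (le_lt_trans (ler_norm M))// ltrDl|exists x].
Qed.

(** At vertex 0 the projection [tail] has no limit, but [s] is bounded and its
    coefficient tends to zero. *)
Lemma cone_fun_continuous : continuous cone_fun.
Proof.
move=> x; have cx := @bary_coord_continuous R j.+1 ord0 x.
have [x1|xN1] := eqVneq ((bary x) 0 ord0) 1; last first.
  apply: (continuous_combination (f := fun x => s (tail x))) => //.
  apply: (@continuous_comp _ _ _ (@tail j) s); first exact: tail_cvg.
  exact: cts_fun.
have [M M0 HM] := singular_simplex_bounded.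
apply/continuous_at_normP => e e0; apply/nbhs_simplexP.
have aM0 : 0 < `|a| + M by rewrite ltr_wpDl.
exists (e / (`|a| + M)); first exact: divr_gt0.
move=> y /mx_norm_ltP; rewrite divr_gt0// => /(_ isT 0 ord0).
rewrite !mxE x1 ltr_pdivlMr// => ye.
rewrite /cone_fun x1 subrr scale0r addr0 scale1r.
have -> : a - ((bary y) 0 ord0 *: a +
    (1 - (bary y) 0 ord0) *: s (tail y)) =
    (1 - (bary y) 0 ord0) *: (a - s (tail y)).
  by rewrite scalerBr opprD addrA -[X in X - _ - _ = _]scale1r -scalerBl.
rewrite normrZ (le_lt_trans _ ye)// ler_wpM2l//.
by rewrite (le_trans (ler_normB _ _))// lerD2l.
Qed.

Definition cone : singular_simplex R V j.+1 := mkcts cone_fun_continuous.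

Lemma face0_cone : face ord0 cone = s.
Proof.
apply/continuousEP => x; rewrite /= /mkcts /cone_fun.
have x0 : bary (face_map ord0 x) 0 ord0 = 0.
  by rewrite mxE unlift_none.
rewrite x0 scale0r add0r subr0 scale1r; congr (s _).
apply: bary_inj; rewrite bary_tail /tail_row x0 eq_sym oner_eq0.
by apply/rowP => k; rewrite mxE bary_face mxE liftK subr0 divr1.
Qed.

End ConeSimplex.

(** With [face0_cone], the reason why coning is a contracting homotopy: every
    other face of a cone is the cone of a face. *)
Lemma faceS_cone a j (s : singular_simplex R V j.+1) (i : 'I_j.+2) :
  face (lift ord0 i) (cone a s) = cone a (face i s).
Proof.
apply/continuousEP => x; rewrite /= /mkcts /cone_fun.
have y0 : bary (face_map (lift ord0 i) x) 0 ord0 =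
          (bary x) 0 ord0.
  rewrite mxE; case: unliftP => [k /(congr1 val) /= |/(congr1 val) //].
  by rewrite /bump /= => kE; congr (_ _ _); apply: val_inj => /=; lia.
rewrite y0; congr (_ + _).
have [->|xN1] := eqVneq ((bary x) 0 ord0) 1.
  by rewrite subrr !scale0r.
congr (_ *: s _); apply: bary_inj.
rewrite bary_face !bary_tail /tail_row y0 (negbTE xN1); apply/rowP => k.
rewrite !mxE.
case: (unliftP i k) => [l ->|->]; last first.
  by rewrite unlift_none mul0r.
rewrite (_ : lift ord0 (lift i l) = lift (lift ord0 i) (lift ord0 l)).
  by rewrite liftK mxE.
by apply: val_inj => /=; rewrite /bump/=; lia.
Qed.

Definition const_simplex (X : topologicalType) (p : X) j :
  singular_simplex R X j := cst p.

Lemma face1_cone a (s : singular_simplex R V 0) :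
  face (lift ord0 ord0) (cone a s) = const_simplex (a : V) 0.
Proof.
apply/continuousEP => x; rewrite /= /mkcts /cone_fun.
have y0 : bary (face_map (lift ord0 ord0 : 'I_2) x) 0 ord0 = 1.
  rewrite mxE; case: unliftP => [k _|/(congr1 val)//].
  by have [_] := baryP x; rewrite big_ord1 (ord1 k).
by rewrite y0 subrr scale0r addr0 scale1r.
Qed.

Definition cone_chain a j : {linear chain K R V j -> chain K R V j.+1} :=
  chain_ext (fun s => gen (cone a s)).

Lemma cone_chainU a j (s : singular_simplex R V j) :
  cone_chain a j (gen s) = gen (cone a s).
Proof. exact: chain_extU. Qed.

(** Hence a normed space is acyclic in positive degree. *)
Lemma boundary_cone a j (c : chain K R V j.+1) :
  boundary K R V j.+2 (cone_chain a j.+1 c) =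
  c - cone_chain a j (boundary K R V j.+1 c).
Proof.
elim/chain_ind: c => [|k s c IH]; first by rewrite !(linear0, subr0).
have sE : boundary K R V j.+2 (gen (cone a s)) =
    gen s - cone_chain a j (boundary K R V j.+1 (gen s)).
  rewrite (boundaryU K (cone a s)) (boundaryU K s).
  rewrite big_ord_recl face0_cone expr0 scale1r linear_sum -sumrN.
  congr (_ + _); apply: eq_bigr => i _.
  by rewrite faceS_cone linearZ /= cone_chainU /bump /= exprS mulN1r scaleNr.
by rewrite !linearP IH !cone_chainU sE scalerBr addrACA -scalerN.
Qed.

Definition augmentation (X : topologicalType) :
  {linear chain K R X 0 -> K^o} := chain_ext (fun=> 1).

Lemma augmentationU (X : topologicalType) (s : singular_simplex R X 0) :
  augmentation X (gen s) = 1.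
Proof. exact: chain_extU. Qed.

Lemma boundary_cone0 a (c : chain K R V 0) :
  boundary K R V 1 (cone_chain a 0 c) =
  c - augmentation V c *: gen (const_simplex (a : V) 0).
Proof.
elim/chain_ind: c => [|k s c IH]; first by rewrite !(linear0, subr0, scale0r).
have sE : boundary K R V 1 (gen (cone a s)) =
    gen s - gen (const_simplex (a : V) 0).
  rewrite (boundaryU K (cone a s)) big_ord_recl big_ord1 face0_cone.
  by rewrite face1_cone expr0 scale1r expr1 scaleN1r.
rewrite !linearP IH !cone_chainU sE augmentationU scalerBr scalerDl opprD.
by rewrite addrACA -[k *: 1]/(k * 1) mulr1.
Qed.

End Cone.

Section ConeNaturality.
Variables (K : nzRingType) (R : realType) (V : normedModType R).

Lemma push_cone (f : continuousType V V) a j (c : chain K R V j) :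
  (forall (t : R) x y, f (t *: x + (1 - t) *: y) = t *: f x + (1 - t) *: f y) ->
  push f (cone_chain K a j c) = cone_chain K (f a) j (push f c).
Proof.
move=> faff.
rewrite -[LHS]/((push f \o cone_chain K a j) c).
rewrite -[RHS]/((cone_chain K (f a) j \o push f) c).
apply: linear_chain_eq => s.
rewrite -[LHS]/(push f (cone_chain K a j (gen s))).
rewrite -[RHS]/(cone_chain K (f a) j (push f (gen s))).
rewrite cone_chainU !pushU cone_chainU; congr gen.
by apply/continuousEP => x; rewrite /= /mkcts /cone_fun faff.
Qed.

End ConeNaturality.

(** * Equivariant homotopies *)

Section Homotopy.
Variables (K : nzRingType) (R : realType) (V : normedModType R).

Lemma translate_continuous (u : V) : continuous (fun y : V => y + u).
Proof. by move=> y; apply: cvgD; [exact: cvg_id|exact: cvg_cst]. Qed.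

Definition translate (u : V) : continuousType V V :=
  mkcts (@translate_continuous u).

Variables f g : continuousType V V.

(** A chain homotopy from [f] to [g], without prisms: the chain
    [push g s - push f s - homotopy (boundary s)] is a cycle, and coning it
    off bounds it.  The apex, the image by [f] of vertex 0 of [s], is chosen so
    that the construction commutes with translations
    ([homotopy_translate]). *)
Fixpoint homotopy j : {linear chain K R V j -> chain K R V j.+1} :=
  match j with
  | 0 => chain_ext (fun s =>
      cone_chain K (f (s (vertex0 R 0))) 0 (push g (gen s) - push f (gen s)))
  | j'.+1 => chain_ext (fun s =>
      cone_chain K (f (s (vertex0 R j'.+1))) j'.+1
        (push g (gen s) - push f (gen s) -
         homotopy j' (boundary K R V j'.+1 (gen s))))
  end.

Lemma boundary_homotopy0 c :
  boundary K R V 1 (homotopy 0 c) = push g c - push f c.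
Proof.
rewrite -[LHS]/((boundary K R V 1 \o homotopy 0) c).
rewrite -[RHS]/((push g \- push f) c).
apply: linear_chain_eq => s.
rewrite -[LHS]/(boundary K R V 1 (homotopy 0 (gen s))).
rewrite [homotopy 0 _]chain_extU boundary_cone0 linearB /=.
by rewrite !pushU !augmentationU subrr scale0r subr0.
Qed.

Lemma boundary_homotopyS j c :
  boundary K R V j.+2 (homotopy j.+1 c) + homotopy j (boundary K R V j.+1 c) =
  push g c - push f c.
Proof.
elim: j c => [|j IH] c.
  rewrite -[LHS]/(((boundary K R V 2 \o homotopy 1) \+
    (homotopy 0 \o boundary K R V 1)) c).
  rewrite -[RHS]/((push g \- push f) c).
  apply: linear_chain_eq => s.
  rewrite -[LHS]/(boundary K R V 2 (homotopy 1 (gen s)) +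
    homotopy 0 (boundary K R V 1 (gen s))).
  rewrite [homotopy 1 _]chain_extU boundary_cone.
  set w := push g (gen s) - _ - _.
  suff -> : boundary K R V 1 w = 0 by rewrite linear0 subr0 subrK.
  by rewrite /w !linearB boundary_homotopy0 !boundary_push subrr.
rewrite -[LHS]/(((boundary K R V j.+3 \o homotopy j.+2) \+
  (homotopy j.+1 \o boundary K R V j.+2)) c).
rewrite -[RHS]/((push g \- push f) c).
apply: linear_chain_eq => s.
rewrite -[LHS]/(boundary K R V j.+3 (homotopy j.+2 (gen s)) +
  homotopy j.+1 (boundary K R V j.+2 (gen s))).
rewrite [homotopy j.+2 _]chain_extU boundary_cone.
set w := push g (gen s) - _ - _.
suff -> : boundary K R V j.+2 w = 0 by rewrite linear0 subr0 subrK.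
have := IH (boundary K R V j.+2 (gen s)).
rewrite boundary_boundary linear0 addr0 => E.
by rewrite /w !linearB E !boundary_push subrr.
Qed.

(** This makes the homotopy descend to quotients by lattices. *)
Lemma homotopy_translate u u' j c :
  (forall y, f (y + u) = f y + u') -> (forall y, g (y + u) = g y + u') ->
  homotopy j (push (translate u) c) = push (translate u') (homotopy j c).
Proof.
move=> fu gu; have pE (k : continuousType V V) i (d : chain K R V i) :
    (forall y, k (y + u) = k y + u') ->
    push k (push (translate u) d) = push (translate u') (push k d).
  move=> ku; rewrite (push_comp _ (h := k \o translate u))//.
  by rewrite (push_comp _ (h := k \o translate u))// => y; rewrite /= /mkcts ku.
have pC b i (d : chain K R V i) : push (translate u') (cone_chain K b i d) =
    cone_chain K (b + u') i (push (translate u') d).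
  apply: (push_cone (f := translate u')) => t x y.
  rewrite /= /mkcts !scalerDr addrACA -scalerDl.
  by rewrite (addrC t) subrK scale1r.
elim: j c => [|j IH] c.
  rewrite -[LHS]/((homotopy 0 \o push (translate u)) c).
  rewrite -[RHS]/((push (translate u') \o homotopy 0) c).
  apply: linear_chain_eq => s.
  rewrite -[LHS]/(homotopy 0 (push (translate u) (gen s))).
  rewrite -[RHS]/(push (translate u') (homotopy 0 (gen s))).
  rewrite pushU ![homotopy 0 _]chain_extU pC -!pushU !linearB !pE//.
  by rewrite /= /mkcts fu.
rewrite -[LHS]/((homotopy j.+1 \o push (translate u)) c).
rewrite -[RHS]/((push (translate u') \o homotopy j.+1) c).
apply: linear_chain_eq => s.
rewrite -[LHS]/(homotopy j.+1 (push (translate u) (gen s))).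
rewrite -[RHS]/(push (translate u') (homotopy j.+1 (gen s))).
rewrite pushU ![homotopy j.+1 _]chain_extU pC -!pushU boundary_push IH.
by rewrite !linearB !pE// /= /mkcts fu.
Qed.

End Homotopy.

(** * Chains of the quotient of a vector space by a lattice *)

Section Lattice.
Variables (A : nzRingType) (R : realType) (n : nat).
Local Notation V := 'cV[R]_n.
Local Notation chain := (chain A R V).
Local Notation bd := (boundary A R V).
Implicit Types (K : {set 'I_n}) (u : V).

Definition basis_vector (k : 'I_n) : V := delta_mx k 0.
Local Notation e := basis_vector.

(** A plain function with its own linearity lemmas: rewriting in sums of
    translated chains is much faster than through the linear map [push]. *)
Definition tpush u j (c : chain j) : chain j := push (translate u) c.
Arguments tpush u {j} c.

Lemma tpush_add u v j (c : chain j) : tpush u (tpush v c) = tpush (u + v) c.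
Proof. by apply: push_comp => y; rewrite /= /mkcts [u + v]addrC addrA. Qed.

Lemma tpush0 j (c : chain j) : tpush 0 c = c.
Proof. by apply: push_id => y; rewrite /= /mkcts addr0. Qed.

Lemma tpushP u j a (c d : chain j) :
  tpush u (a *: c + d) = a *: tpush u c + tpush u d.
Proof. exact: linearP. Qed.

Lemma tpushr0 u j : tpush u (0 : chain j) = 0.
Proof. exact: linear0. Qed.

Lemma tpushD u j (c d : chain j) : tpush u (c + d) = tpush u c + tpush u d.
Proof. exact: linearD. Qed.

Lemma tpushZ u j a (c : chain j) : tpush u (a *: c) = a *: tpush u c.
Proof. exact: linearZ. Qed.

Lemma tpushB u j (c d : chain j) : tpush u (c - d) = tpush u c - tpush u d.
Proof. exact: linearB. Qed.

Lemma boundaryB j (c d : chain j) : bd j (c - d) = bd j c - bd j d.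
Proof. exact: linearB. Qed.

Lemma boundaryD j (c d : chain j) : bd j (c + d) = bd j c + bd j d.
Proof. exact: linearD. Qed.

Lemma boundary_tpush u j (c : chain j) : bd j (tpush u c) = tpush u (bd j c).
Proof. exact: boundary_push. Qed.

(** The chains that vanish in the coinvariants of the group Z^K of integral
    translations along the coordinates in [K], that is, in the chains of the
    quotient of the space by Z^K. *)
Definition lattice_zero K j (c : chain j) : Prop :=
  exists y : 'I_n -> chain j, c = \sum_(k in K) (tpush (e k) (y k) - y k).

Lemma lattice_zero0 K j : lattice_zero K (0 : chain j).
Proof.
by exists (fun=> 0); rewrite big1// => k _; rewrite tpushr0 subrr.
Qed.

Lemma lattice_zeroD K j (c d : chain j) :
  lattice_zero K c -> lattice_zero K d -> lattice_zero K (c + d).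
Proof.
move=> [y ->] [z ->]; exists (fun k => y k + z k); rewrite -big_split /=.
by apply: eq_bigr => k _; rewrite tpushD opprD addrACA.
Qed.

Lemma lattice_zeroZ K j a (c : chain j) :
  lattice_zero K c -> lattice_zero K (a *: c).
Proof.
move=> [y ->]; exists (fun k => a *: y k); rewrite scaler_sumr.
by apply: eq_bigr => k _; rewrite tpushZ scalerBr.
Qed.

Lemma lattice_zeroN K j (c : chain j) : lattice_zero K c -> lattice_zero K (- c).
Proof. by rewrite -scaleN1r; exact: lattice_zeroZ. Qed.

Lemma lattice_zeroB K j (c d : chain j) :
  lattice_zero K c -> lattice_zero K d -> lattice_zero K (c - d).
Proof. by move=> ? ?; apply: lattice_zeroD => //; exact: lattice_zeroN. Qed.

Lemma lattice_zero_sum K j I (r : seq I) (P : pred I) (F : I -> chain j) :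
  (forall i, P i -> lattice_zero K (F i)) ->
  lattice_zero K (\sum_(i <- r | P i) F i).
Proof.
move=> FP; apply: big_rec => [|i c Pi]; first exact: lattice_zero0.
exact/lattice_zeroD/FP.
Qed.

Lemma lattice_zero_gen K j k (c : chain j) :
  k \in K -> lattice_zero K (tpush (e k) c - c).
Proof.
move=> kK; exists (fun i => if i == k then c else 0).
rewrite (bigD1 k)//= eqxx big1 ?addr0// => i /andP[_ /negbTE->].
by rewrite tpushr0 subrr.
Qed.

Lemma lattice_zero_linear K i j (f : {linear chain i -> chain j}) c :
  (forall k d, k \in K -> lattice_zero K (f (tpush (e k) d) - f d)) ->
  lattice_zero K c -> lattice_zero K (f c).
Proof.
move=> fK [y ->]; rewrite linear_sum; apply: lattice_zero_sum => k kK.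
by rewrite linearB; exact: fK.
Qed.

Lemma lattice_zero_boundary K j (c : chain j) :
  lattice_zero K c -> lattice_zero K (bd j c).
Proof.
apply: lattice_zero_linear => k d kK; rewrite boundary_tpush.
exact: lattice_zero_gen.
Qed.

Lemma lattice_zeroS K K' j (c : chain j) :
  K \subset K' -> lattice_zero K c -> lattice_zero K' c.
Proof.
move=> /fintype.subsetP KK' [y ->]; apply: lattice_zero_sum => k /KK'.
exact: lattice_zero_gen.
Qed.

Lemma lattice_zero_set0 j (c : chain j) : lattice_zero finset.set0 c -> c = 0.
Proof. by move=> [y ->]; rewrite big_set0. Qed.

Lemma lattice_zeroU1 K k j (c : chain j) : k \notin K ->
  lattice_zero (k |: K) c ->
  exists y, lattice_zero K (c - (tpush (e k) y - y)).
Proof.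
move=> kK [y ->]; exists (y k); rewrite big_setU1//= addrAC subrr add0r.
by exists y.
Qed.

Definition lattice_vector K u : Prop :=
  forall k, u k 0 \is a Num.int /\ (k \notin K -> u k 0 = 0).

(** From the generators of Z^K to all its elements, since
    t_u t_v - 1 = t_u (t_v - 1) + (t_u - 1). *)
Lemma lattice_zero_tpush K u j (c : chain j) : lattice_vector K u ->
  lattice_zero K (tpush u c - c).
Proof.
pose good v := forall j (c : chain j), lattice_zero K (tpush v c - c).
have goodD v w : good v -> good w -> good (v + w).
  move=> vg wg i d; rewrite -tpush_add -(subrK (tpush w d) (tpush v _)) -addrA.
  exact: lattice_zeroD.
have goodN v : good v -> good (- v).
  move=> vg i d; have := vg i (tpush (- v) d); rewrite tpush_add subrr tpush0.
  by move=> /lattice_zeroN; rewrite opprB.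
have good0 : good 0 by move=> i d; rewrite tpush0 subrr; exact: lattice_zero0.
have goodn k (m : nat) : k \in K -> good (e k *+ m).
  move=> kK; elim: m => [|m IH]; first by rewrite mulr0n.
  by rewrite mulrS; apply: goodD => // i d; exact: lattice_zero_gen.
move=> uK; suff : good u by apply.
rewrite (matrix_sum_delta u); elim/big_rec: _ => // k v _; apply: goodD.
rewrite big_ord1; have [/intrP[m ->]] := uK k.
have [kK _|kK ->//] := boolP (k \in K); last by rewrite scale0r.
rewrite scaler_int; case: m => m; first by rewrite -pmulrn; exact: goodn.
by rewrite NegzE mulrNz -pmulrn; apply/goodN/goodn.
Qed.

Definition lattice_compatible K (f : continuousType V V) : Prop :=
  forall k, k \in K ->
  exists2 u, lattice_vector K u & forall y, f (y + e k) = f y + u.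

Lemma push_tpush (f : continuousType V V) u u' j (c : chain j) :
  (forall y, f (y + u) = f y + u') -> push f (tpush u c) = tpush u' (push f c).
Proof.
move=> fu; rewrite [LHS](push_comp _ (h := f \o translate u))//.
by rewrite [RHS](push_comp _ (h := f \o translate u))// => y; rewrite /= /mkcts fu.
Qed.

Lemma lattice_zero_push K f j (c : chain j) : lattice_compatible K f ->
  lattice_zero K c -> lattice_zero K (push f c).
Proof.
move=> fK; apply: lattice_zero_linear => k d /fK[u uK fu].
by rewrite (push_tpush _ fu); exact: lattice_zero_tpush.
Qed.

(** The chains that become boundaries in the quotient by Z^K. *)
Definition null K j (z : chain j) : Prop :=
  exists b : chain j.+1, lattice_zero K (z - bd j.+1 b).

Lemma null_lattice_zero K j (z : chain j) : lattice_zero K z -> null K z.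
Proof. by exists 0; rewrite linear0 subr0. Qed.

Lemma null_boundary K j (b : chain j.+1) : null K (bd j.+1 b).
Proof. by exists b; rewrite subrr; exact: lattice_zero0. Qed.

Lemma nullD K j (c d : chain j) : null K c -> null K d -> null K (c + d).
Proof.
move=> [b cb] [b' db]; exists (b + b').
by rewrite linearD opprD addrACA; exact: lattice_zeroD.
Qed.

Lemma nullZ K j a (c : chain j) : null K c -> null K (a *: c).
Proof.
by move=> [b cb]; exists (a *: b); rewrite linearZ -scalerBr; exact: lattice_zeroZ.
Qed.

Lemma nullN K j (c : chain j) : null K c -> null K (- c).
Proof. by rewrite -scaleN1r; exact: nullZ. Qed.

Lemma nullB K j (c d : chain j) : null K c -> null K d -> null K (c - d).
Proof. by move=> ? ?; apply: nullD => //; exact: nullN. Qed.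

Lemma nullS K K' j (c : chain j) : K \subset K' -> null K c -> null K' c.
Proof. by move=> KK' [b cb]; exists b; exact: lattice_zeroS cb. Qed.

Lemma null_push K f j (c : chain j) : lattice_compatible K f ->
  null K c -> null K (push f c).
Proof.
move=> fK [b cb]; exists (push f b); rewrite boundary_push -linearB.
exact: lattice_zero_push.
Qed.

(** Two maps that are equivariant for the same homomorphism of Z^K induce
    homotopic maps of the quotient by Z^K, the homotopy between them being
    equivariant as well. *)
Lemma null_homotopy K (f g : continuousType V V) j (z : chain j) :
  (forall k, k \in K -> exists2 u, lattice_vector K u &
     (forall y, f (y + e k) = f y + u) /\ (forall y, g (y + e k) = g y + u)) ->
  lattice_zero K (bd j z) -> null K (push g z - push f z).
Proof.
move=> fg zK; case: j z zK => [|j] z zK.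
  by rewrite -boundary_homotopy0; exact: null_boundary.
rewrite -boundary_homotopyS; apply: nullD; first exact: null_boundary.
apply/null_lattice_zero/(lattice_zero_linear _ zK) => k d /fg[u uK [fu gu]].
by rewrite (homotopy_translate _ fu gu); exact: lattice_zero_tpush.
Qed.

(** Translating every simplex so that the coordinates in [K] of its vertex 0
    lie in [0, 1) picks one representative in each orbit of Z^K.  It identifies
    the coinvariants of Z^K with a free module on which the translations along
    the other coordinates still act freely. *)
Section Regularity.
Variable K : {set 'I_n}.

Definition floor_shift (v : V) : V :=
  \col_k (if k \in K then - (Num.floor (v k 0))%:~R else 0).

Definition normalize_simplex j (s : singular_simplex R V j) :=
  push_simplex (translate (floor_shift (s (vertex0 R j)))) s.

Definition normalize j : {linear chain j -> chain j} :=
  chain_ext (fun s => gen (normalize_simplex s)).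

Lemma lattice_vector_floor_shift v : lattice_vector K (floor_shift v).
Proof.
move=> k; rewrite mxE; case: ifP => kK; split=> //.
by rewrite rpredN intr_int.
Qed.

Lemma normalize_sub j (c : chain j) : lattice_zero K (normalize j c - c).
Proof.
elim/chain_ind: c => [|a s c IH].
  by rewrite linear0 subrr; exact: lattice_zero0.
rewrite linearP opprD addrACA; apply: lattice_zeroD => //.
rewrite -scalerBr; apply: lattice_zeroZ.
rewrite [normalize j _]chain_extU /normalize_simplex -pushU.
exact/lattice_zero_tpush/lattice_vector_floor_shift.
Qed.

Lemma floor_shift_in v k : k \in K -> floor_shift (v + e k) + e k = floor_shift v.
Proof.
move=> kK; apply/colP => i; rewrite !mxE eqxx andbT.
case: ifP => iK; last first.
  by case: eqVneq => [ik|_]; [rewrite ik kK in iK|rewrite addr0].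
case: eqP => _; last by rewrite !addr0.
by rewrite floorDrz ?int_num1// floor1 intrD opprD subrK.
Qed.

Lemma floor_shift_out v k : k \notin K -> floor_shift (v + e k) = floor_shift v.
Proof.
move=> kK; apply/colP => i; rewrite !mxE eqxx andbT.
case: ifP => iK //; case: eqVneq => [ik|_]; last by rewrite addr0.
by rewrite -ik iK in kK.
Qed.

Lemma normalize_in j k (c : chain j) : k \in K ->
  normalize j (tpush (e k) c) = normalize j c.
Proof.
move=> kK; rewrite -[LHS]/((normalize j \o push (translate (e k))) c).
apply: linear_chain_eq => s.
rewrite -[LHS]/(normalize j (tpush (e k) (gen s))).
rewrite [tpush _ _]pushU ![normalize j _]chain_extU; congr gen.
apply/continuousEP => x; rewrite /= /mkcts.
by rewrite -addrA [e k + _]addrC floor_shift_in.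
Qed.

Lemma normalize_out j k (c : chain j) : k \notin K ->
  normalize j (tpush (e k) c) = tpush (e k) (normalize j c).
Proof.
move=> kK; rewrite -[LHS]/((normalize j \o push (translate (e k))) c).
rewrite -[RHS]/((push (translate (e k)) \o normalize j) c).
apply: linear_chain_eq => s.
rewrite -[LHS]/(normalize j (tpush (e k) (gen s))).
rewrite -[RHS]/(tpush (e k) (normalize j (gen s))).
rewrite [tpush _ _]pushU ![normalize j _]chain_extU [RHS]pushU; congr gen.
apply/continuousEP => x; rewrite /= /mkcts.
by rewrite floor_shift_out// addrAC.
Qed.

Lemma normalize_lattice_zero j (c : chain j) : lattice_zero K c -> normalize j c = 0.
Proof.
move=> [y ->]; rewrite linear_sum big1// => k kK.
by rewrite linearB /= normalize_in// subrr.
Qed.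

End Regularity.

Lemma coeff_tpush u j s (c : chain j) :
  coeff (push_simplex (translate u) s) (tpush u c) = coeff s c.
Proof.
elim/chain_ind: c => [|a t c IH]; first by rewrite tpushr0 !coeff0.
rewrite tpushP !coeffD !coeffZ IH [tpush u _]pushU !coeff_fgen.
congr (_ * (nat_of_bool _)%:R + _); apply/eqP/eqP => [/continuousEP st|->//].
by apply/continuousEP => x; have := st x; rewrite /= /mkcts => /addIr.
Qed.

(** The support of a chain is finite while a simplex has infinitely many
    translates. *)
Lemma tpush_fixed_eq0 k j (c : chain j) : tpush (e k) c = c -> c = 0.
Proof.
move=> ck; apply/eqP; rewrite -dom_eq0; apply/negP => /negP.
case E : (dom c) => [//|s l] _.
have s0 : s \in dom c by rewrite E mem_head.
pose t i := push_simplex (translate (e k *+ i)) s.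
have ti i : t i \in dom c.
  elim: i => [|i].
    by rewrite (_ : t 0%N = s)//; apply/continuousEP => x; rewrite /= /mkcts addr0.
  rewrite !mem_dom -{2}ck; congr (_ != 0).
  rewrite -(coeff_tpush (e k)); congr coeff.
  by apply/continuousEP => x; rewrite /= /mkcts mulrS -addrA [e k + _]addrC.
have t_inj : injective t.
  move=> i i' /continuousEP/(_ (vertex0 R j)); rewrite /= /mkcts => /addrI.
  move=> /colP/(_ k); rewrite !mulmxnE !mxE !eqxx.
  by move=> /eqP; rewrite eqr_nat => /eqP.
have : (size (map t (iota 0 (size (dom c)).+1)) <= size (dom c))%N.
  apply: uniq_leq_size; first by rewrite map_inj_uniq// iota_uniq.
  by move=> _ /mapP[i _ ->].
by rewrite size_map size_iota ltnn.
Qed.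

(** The step that adds one coordinate to [K] rests on this: t_k - 1 is
    injective on the coinvariants of Z^K. *)
Lemma lattice_zero_regular K k j (c : chain j) : k \notin K ->
  lattice_zero K (tpush (e k) c - c) -> lattice_zero K c.
Proof.
move=> kK cK; have := normalize_lattice_zero cK.
rewrite linearB normalize_out// => /eqP; rewrite subr_eq0 => /eqP.
move=> /tpush_fixed_eq0 c0; have := normalize_sub K c.
by rewrite c0 sub0r => /lattice_zeroN; rewrite opprK.
Qed.

End Lattice.
Arguments tpush {A R n} u {j} c.
Arguments basis_vector {R n} k.

Lemma continuous_mx (T : topologicalType) (R : realType) m n
    (f : T -> 'M[R]_(m, n)) x :
  (forall i j, {for x, continuous (fun t => f t i j)}) -> {for x, continuous f}.
Proof. exact: cvg_mx. Qed.

(** Identities between combinations of chains, checked on coefficients. *)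
Ltac chain_ring := apply/eqP/freeg_eqP => ?;
  rewrite ?(coeffB, coeffD, coeffN, coeffMn); ring.

(** * Reflections and projections of the coordinates *)

Section DiagonalMaps.
Variables (A : comNzRingType) (R : realType) (n : nat).
Local Notation V := 'cV[R]_n.
Local Notation chain := (chain A R V).
Local Notation bd := (boundary A R V).
Local Notation e := basis_vector.
Implicit Types (K : {set 'I_n}) (d : 'I_n -> R) (b u : V).

Definition diag_fun d b (y : V) : V := \col_k (d k * y k 0) + b.

Lemma diag_fun_continuous d b : continuous (diag_fun d b).
Proof.
move=> y; apply: continuousD; last exact: cst_continuous.
apply: continuous_mx => i j.
have -> : (fun x : V => (\col_k (d k * x k 0) : V) i j) = (fun x : V => d i * x i 0).
  by apply/funext => x; rewrite mxE.
by apply: continuousM; [exact: cst_continuous|exact: coord_continuous].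
Qed.

Definition diag_map d b : continuousType V V :=
  mkcts (@diag_fun_continuous d b).

Definition dpush d b j (c : chain j) : chain j := push (diag_map d b) c.
Arguments dpush d b {j} c.

Lemma dpushD d b j (x y : chain j) :
  dpush d b (x + y) = dpush d b x + dpush d b y.
Proof. exact: linearD. Qed.

Lemma dpushN d b j (x : chain j) : dpush d b (- x) = - dpush d b x.
Proof. exact: linearN. Qed.

Lemma dpushMn d b j (x : chain j) m : dpush d b (x *+ m) = dpush d b x *+ m.
Proof. exact: linearMn. Qed.

Lemma dpushr0 d b j : dpush d b (0 : chain j) = 0.
Proof. exact: linear0. Qed.

Lemma dpushB d b j (x y : chain j) :
  dpush d b (x - y) = dpush d b x - dpush d b y.
Proof. exact: linearB. Qed.

Lemma eq_dpush d b d' b' j (c : chain j) : d =1 d' -> b = b' ->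
  dpush d b c = dpush d' b' c.
Proof. by move=> /funext -> ->. Qed.

Lemma dpush_comp d b d' b' j (c : chain j) :
  dpush d b (dpush d' b' c) =
  dpush (fun k => d k * d' k) (\col_k (d k * b' k 0) + b) c.
Proof.
apply: push_comp => y; apply/colP => i.
by rewrite /= /mkcts /diag_fun !mxE mulrDr mulrA addrA.
Qed.

Lemma dpush_id j (c : chain j) : dpush (fun=> 1) 0 c = c.
Proof.
apply: push_id => y; apply/colP => i.
by rewrite /= /mkcts /diag_fun !mxE mul1r addr0.
Qed.

Lemma tpushE u j (c : chain j) : tpush u c = dpush (fun=> 1) u c.
Proof.
apply: eq_push => y; apply/colP => i.
by rewrite /= /mkcts /diag_fun !mxE mul1r.
Qed.

Lemma diag_mapD d b u y :
  diag_map d b (y + u) = diag_map d b y + \col_k (d k * u k 0).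
Proof.
by apply/colP => i; rewrite /= /mkcts /diag_fun !mxE mulrDr addrAC.
Qed.

Lemma dpush_tpush d b u j (c : chain j) :
  dpush d b (tpush u c) = tpush (\col_k (d k * u k 0)) (dpush d b c).
Proof. by apply: push_tpush => y; exact: diag_mapD. Qed.

Lemma diag_basis d k : \col_i (d i * e k i 0) = d k *: (e k : V).
Proof.
apply/colP => i; rewrite !mxE eqxx andbT.
by case: eqVneq => [->|_]; rewrite ?mulr0.
Qed.

Lemma lattice_vector_basis K k a : a \is a Num.int -> k \in K ->
  lattice_vector K (a *: (e k : V)).
Proof.
move=> aZ kK i; rewrite !mxE eqxx andbT.
case: eqVneq => [->|_]; first by rewrite mulr1 kK.
by rewrite mulr0 rpred0.
Qed.

Lemma diag_map_basis K d b k : d k \is a Num.int -> k \in K ->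
  exists2 u, lattice_vector K u &
    forall y, diag_map d b (y + e k) = diag_map d b y + u.
Proof.
move=> dZ kK; exists (d k *: e k); first exact: lattice_vector_basis.
by move=> y; rewrite diag_mapD diag_basis.
Qed.

Lemma diag_map_compatible K d b : (forall k, k \in K -> d k \is a Num.int) ->
  lattice_compatible K (diag_map d b).
Proof. by move=> dZ k kK; apply: diag_map_basis => //; exact: dZ. Qed.

Lemma lattice_zero_dpush K d b j (c : chain j) :
  (forall k, k \in K -> d k \is a Num.int) ->
  lattice_zero K c -> lattice_zero K (dpush d b c).
Proof. by move=> dZ; apply/lattice_zero_push/diag_map_compatible. Qed.

Lemma null_dpush K d b j (c : chain j) :
  (forall k, k \in K -> d k \is a Num.int) ->
  null K c -> null K (dpush d b c).
Proof. by move=> dZ; apply/null_push/diag_map_compatible. Qed.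

(** The homotopy class, on the quotient by Z^K, of an affine diagonal map
    depends only on its coefficients in [K]. *)
Lemma null_dpush_sub K d b d' b' j (z : chain j) :
  (forall k, k \in K -> d' k \is a Num.int /\ d k = d' k) ->
  lattice_zero K (bd j z) -> null K (dpush d b z - dpush d' b' z).
Proof.
move=> dd'; apply: null_homotopy => k kK; have [dZ ddk] := dd' k kK.
exists (d' k *: e k); first exact: lattice_vector_basis.
by split=> y; rewrite diag_mapD diag_basis ?ddk.
Qed.

Lemma boundary_dpush d b j (c : chain j) : bd j (dpush d b c) = dpush d b (bd j c).
Proof. exact: boundary_push. Qed.

Definition flip (k i : 'I_n) : R := if i == k then -1 else 1.
Definition kill (k i : 'I_n) : R := if i == k then 0 else 1.
(* [kill k] forgets the k-th coordinate, [keep k] all the others *)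
Definition keep (k i : 'I_n) : R := if i == k then 1 else 0.

Lemma flip_int k i : flip k i \is a Num.int.
Proof. by rewrite /flip; case: ifP; rewrite ?rpredN ?rpred1. Qed.

Lemma kill_int k i : kill k i \is a Num.int.
Proof. by rewrite /kill; case: ifP; rewrite ?rpred0 ?rpred1. Qed.

Lemma kill_out K k i : k \notin K -> i \in K -> kill k i = 1.
Proof.
by move=> kK iK; rewrite /kill; case: eqVneq => // ik; rewrite -ik iK in kK.
Qed.

Lemma flip_out K k i : k \notin K -> i \in K -> flip k i = 1.
Proof.
by move=> kK iK; rewrite /flip; case: eqVneq => // ik; rewrite -ik iK in kK.
Qed.

Lemma kill_tpush k j (c : chain j) :
  dpush (kill k) 0 (tpush (e k) c) = dpush (kill k) 0 c.
Proof. by rewrite dpush_tpush diag_basis /kill eqxx scale0r tpush0. Qed.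

Section Step.
Variables (K : {set 'I_n}) (k : 'I_n) (kK : k \notin K).

Lemma null_setU1 j (z u : chain j) : null K (z - (tpush (e k) u - u)) ->
  null (k |: K) z.
Proof.
move=> /(nullS (finset.subsetUr [set k]%SET K)) zu.
rewrite -(subrK (tpush (e k) u - u) z); apply: nullD => //.
by apply/null_lattice_zero/lattice_zero_gen; rewrite setU11.
Qed.

(** The projection [kill k] is homotopic to the identity on the quotient by
    Z^K, because [k] is not in [K]. *)
Lemma null_kill_sub j (x : chain j) : lattice_zero K (bd j x) ->
  dpush (kill k) 0 x = 0 -> null K x.
Proof.
move=> bx px; rewrite -[x]subr0 -px -[X in X - _](dpush_id x).
by apply: null_dpush_sub => // i iK; rewrite kill_int (kill_out kK).
Qed.

Lemma lattice_zero_tpush_sub j (w : chain j) :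
  lattice_zero K w -> lattice_zero K (tpush (e k) w - w).
Proof.
move=> wK; apply: lattice_zeroB => //; rewrite tpushE.
by apply: lattice_zero_dpush => // *; rewrite rpred1.
Qed.

Lemma kill_kill j (z : chain j) :
  dpush (kill k) 0 (dpush (kill k) 0 z) = dpush (kill k) 0 z.
Proof.
rewrite dpush_comp; apply: eq_dpush => [i|].
  by rewrite /kill; case: ifP; rewrite ?mul0r ?mul1r.
by apply/colP => i; rewrite !mxE mulr0 addr0.
Qed.

Lemma kill_flip j (z : chain j) :
  dpush (kill k) 0 (dpush (flip k) 0 z) = dpush (kill k) 0 z.
Proof.
rewrite dpush_comp; apply: eq_dpush => [i|].
  by rewrite /kill /flip; case: ifP; rewrite ?mul0r ?mul1r.
by apply/colP => i; rewrite !mxE mulr0 addr0.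
Qed.

(** Let t be the translation along the k-th axis and r the reflection.  Write
    the boundary of z as t y - y modulo K, with y a cycle modulo K.  As
    r t = t^-1 r, the boundary of z + r z is (t - 1)(y - t^-1 r y) modulo K.
    But t^-1 r is homotopic to the identity modulo K, so y - t^-1 r y is the
    boundary of some u modulo K, and z + r z - 2 p z - (t - 1) u is a cycle
    modulo K, which p maps to zero. *)
Lemma flip_kill j (z : chain j.+1) : lattice_zero (k |: K) (bd j.+1 z) ->
  null (k |: K) (z + dpush (flip k) 0 z - dpush (kill k) 0 z *+ 2).
Proof.
move=> /(lattice_zeroU1 kK)[y zy].
(* t - 1 maps the boundary of y to zero modulo K, and is injective there *)
have by0 : lattice_zero K (bd j y).
  apply: (lattice_zero_regular kK).
  move: (lattice_zero_boundary zy); rewrite linearB boundary_boundary sub0r.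
  by move=> /lattice_zeroN; rewrite opprK linearB /= boundary_tpush.
have [u yu] : null K (y - dpush (flip k) (- e k) y).
  rewrite -{1}(dpush_id y); apply: null_dpush_sub => // i iK.
  by rewrite flip_int (flip_out kK).
have rtE (c : chain j) :
    dpush (flip k) 0 (tpush (e k) c) = dpush (flip k) (- e k) c.
  rewrite tpushE dpush_comp; apply: eq_dpush => [i|]; first by rewrite mulr1.
  by rewrite diag_basis /flip eqxx scaleN1r addr0.
have trE (c : chain j) :
    tpush (e k) (dpush (flip k) (- e k) c) = dpush (flip k) 0 c.
  rewrite tpushE dpush_comp; apply: eq_dpush => [i|]; first by rewrite mul1r.
  by apply/colP => i; rewrite !mxE mul1r addNr.
pose x := z + dpush (flip k) 0 z - dpush (kill k) 0 z *+ 2 -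
  (tpush (e k) u - u).
apply: (@null_setU1 _ _ u); apply: null_kill_sub; last first.
  rewrite mulr2n !(dpushB, dpushD) kill_tpush kill_flip kill_kill.
  by chain_ring.
have pE : lattice_zero K (dpush (kill k) 0 (bd j.+1 z)).
  have := @lattice_zero_dpush K (kill k) 0 _ _ (fun i _ => kill_int k i) zy.
  by rewrite !dpushB kill_tpush subrr subr0.
have rE := @lattice_zero_dpush K (flip k) 0 _ _ (fun i _ => flip_int k i) zy.
have wE := lattice_zero_tpush_sub yu.
have := lattice_zeroD (lattice_zeroD zy rE) (lattice_zeroB wE (lattice_zeroD pE pE)).
congr lattice_zero.
rewrite mulr2n !(dpushB, tpushB, boundaryB, boundaryD) rtE trE.
rewrite !boundary_dpush boundary_tpush.
by chain_ring.
Qed.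

Lemma augmentation_push (f : continuousType V V) (c : chain 0) :
  augmentation A R V (push f c) = augmentation A R V c.
Proof.
rewrite -[LHS]/((augmentation A R V \o push f) c).
apply: linear_chain_eq => s.
rewrite -[LHS]/(augmentation A R V (push f (gen s))).
by rewrite pushU !augmentationU.
Qed.

Lemma kill_ne_tpush l j (c : chain j) : l != k ->
  dpush (kill l) 0 (tpush (e k) c) = tpush (e k) (dpush (kill l) 0 c).
Proof.
by move=> lk; rewrite dpush_tpush diag_basis /kill eq_sym (negbTE lk) scale1r.
Qed.

(** The class of z is that of p_k z up to the one determined by the 0-chain y
    for which the boundary of z is t_k y - y modulo K.  Replacing z by
    z - p_l z replaces y by y - p_l y, a 0-chain of augmentation zero, hence a
    boundary. *)
Lemma null_kill_kill1 l (z : chain 1) : l != k ->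
  lattice_zero (k |: K) (bd 1 z) ->
  null (k |: K) ((z - dpush (kill l) 0 z) -
                 dpush (kill k) 0 (z - dpush (kill l) 0 z)).
Proof.
move=> lk /(lattice_zeroU1 kK)[y zy].
pose v := dpush (kill l) 0 y.
(* the apex of the cone is arbitrary *)
pose u := cone_chain A (0 : V) 0 (y - v).
have bu : bd 1 u = y - v.
  rewrite boundary_cone0 linearB [augmentation _ _ _ v]augmentation_push subrr.
  by rewrite scale0r subr0.
pose x := (z - dpush (kill l) 0 z) - (tpush (e k) u - u).
have bx : lattice_zero K (bd 1 x).
  have := lattice_zeroB zy
    (@lattice_zero_dpush K (kill l) 0 _ _ (fun i _ => kill_int l i) zy).
  congr lattice_zero; rewrite /x !(dpushB, boundaryB) kill_ne_tpush//.
  rewrite boundary_dpush boundary_tpush bu tpushB -/v.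
  by chain_ring.
have px : dpush (kill k) 0 x = dpush (kill k) 0 (z - dpush (kill l) 0 z).
  by rewrite /x dpushB [dpush _ _ (tpush _ _ - _)]dpushB kill_tpush subrr subr0.
apply: (@null_setU1 _ _ u); rewrite -px.
have -> : z - dpush (kill l) 0 z - dpush (kill k) 0 x - (tpush (e k) u - u) =
   x - dpush (kill k) 0 x by rewrite /x; chain_ring.
rewrite -{1}(dpush_id x).
by apply: null_dpush_sub => // i iK; rewrite kill_int (kill_out kK).
Qed.

Lemma keep_lattice_zero j (c : chain j) :
  lattice_zero K c -> dpush (keep k) 0 c = 0.
Proof.
move=> [y ->]; rewrite [LHS](linear_sum (push (diag_map _ _))) big1// => l lK.
rewrite -[LHS]/(dpush (keep k) 0 _) dpushB dpush_tpush diag_basis.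
rewrite /keep; case: eqVneq => [lk|_]; last by rewrite scale0r tpush0 subrr.
by move: kK; rewrite -lk lK.
Qed.

Lemma keep_tpush j (c : chain j) :
  dpush (keep k) 0 (tpush (e k) c) = tpush (e k) (dpush (keep k) 0 c).
Proof. by rewrite dpush_tpush diag_basis /keep eqxx scale1r. Qed.

(** The k-th coordinate circle has no homology in degree at least two: on
    the image of [keep k] the translations along [K] act trivially, so the
    boundary of the image is t_k v - v exactly, with v a cycle of the vector
    space, and cones do the rest. *)
Lemma null_keep j (z : chain j.+2) : lattice_zero (k |: K) (bd j.+2 z) ->
  null (k |: K) (dpush (keep k) 0 z).
Proof.
move=> /(lattice_zeroU1 kK)[y zy].
have := keep_lattice_zero zy; rewrite !dpushB keep_tpush => /eqP.
set v := dpush (keep k) 0 y; rewrite subr_eq0 => /eqP bz.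
have bv : bd j.+1 v = 0.
  apply: lattice_zero_set0; apply: (@lattice_zero_regular _ _ _ _ k).
    by rewrite inE.
  rewrite -boundary_tpush -boundaryB -bz boundary_dpush.
  by rewrite boundary_boundary dpushr0; exact: lattice_zero0.
pose u := cone_chain A (0 : V) j.+1 v.
have bu : bd j.+2 u = v by rewrite boundary_cone bv linear0 subr0.
pose x := dpush (keep k) 0 z - (tpush (e k) u - u).
have bx : bd j.+2 x = 0.
  by rewrite /x !boundaryB boundary_dpush bz boundary_tpush bu subrr.
apply: (@null_setU1 _ _ u); rewrite -/x; exists (cone_chain A (0 : V) j.+2 x).
by rewrite boundary_cone bx linear0 subr0 subrr; exact: lattice_zero0.
Qed.

End Step.

Section Conclusions.
Variable j : nat.
Local Notation Z := (lattice_zero (finset.setT : {set 'I_n})).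
Local Notation N := (null (finset.setT : {set 'I_n})).
Local Notation r k := (dpush (flip k) 0).
Local Notation p k := (dpush (kill k) 0).

Lemma setU1T (k : 'I_n) : (k |: (finset.setT :\ k))%SET = finset.setT.
Proof. by rewrite finset.setD1K// inE. Qed.

Lemma null_zero (z : chain j.+1) : Z (bd j.+1 z) -> N (dpush (fun=> 0) 0 z).
Proof.
move=> zZ; exists (cone_chain A (0 : V) j.+1 (dpush (fun=> 0) 0 z)).
rewrite boundary_cone boundary_dpush; case: zZ => y ->.
rewrite [X in cone_chain _ _ _ X](linear_sum (push (diag_map _ _))) big1.
  by rewrite linear0 subr0 subrr; exact: lattice_zero0.
move=> l _; rewrite -[LHS]/(dpush (fun=> 0) 0 _) dpushB dpush_tpush diag_basis.
by rewrite scale0r tpush0 subrr.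
Qed.

Lemma kill_seq (z : chain j) (s : seq 'I_n) :
  (forall k, k \in s -> N (z - p k z)) ->
  N (z - dpush (fun i => if i \in s then 0 else 1) 0 z).
Proof.
elim: s => [|k s IH] sz.
  by rewrite dpush_id subrr; exact/null_lattice_zero/lattice_zero0.
have {}IH : N (z - dpush (fun i => if i \in s then 0 else 1) 0 z).
  by apply: IH => l ls; apply: sz; rewrite inE ls orbT.
have zk : N (dpush (fun i => if i \in s then 0 else 1) 0 (z - p k z)).
  apply: null_dpush; last by apply: sz; rewrite mem_head.
  by move=> i _; case: ifP; rewrite ?rpred0 ?rpred1.
have E : dpush (fun i => if i \in s then 0 else 1) 0 (p k z) =
    dpush (fun i => if i \in k :: s then 0 else 1) 0 z.
  rewrite dpush_comp; apply: eq_dpush => [i|]; last first.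
    by apply/colP => i; rewrite !mxE mulr0 addr0.
  by rewrite inE /kill; do 2![case: ifP => //= _]; rewrite ?mulr0 ?mulr1.
have := nullD IH zk; congr null; rewrite dpushB E.
by chain_ring.
Qed.

End Conclusions.

(** A class fixed by p_k comes from the subtorus of the other coordinates.
    Here nothing is left but a point, and the degree is positive. *)
Lemma null_of_kill j (z : chain j.+1) :
  lattice_zero (finset.setT : {set 'I_n}) (bd j.+1 z) ->
  (forall k, null finset.setT (z - dpush (kill k) 0 z)) -> null finset.setT z.
Proof.
move=> zZ zp; have := @kill_seq j.+1 z (enum 'I_n) (fun k _ => zp k).
rewrite (@eq_dpush _ _ (fun=> 0) 0)//; last by move=> i; rewrite mem_enum.
by move=> /nullD/(_ (null_zero zZ)); rewrite subrK.
Qed.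

(** Here the i-th coordinate circle is left. *)
Lemma null_of_kill_but_one i j (z : chain j.+2) :
  lattice_zero (finset.setT : {set 'I_n}) (bd j.+2 z) ->
  (forall k, k != i -> null finset.setT (z - dpush (kill k) 0 z)) ->
  null finset.setT z.
Proof.
move=> zZ zp; have zi : null finset.setT (dpush (keep i) 0 z).
  by rewrite -(setU1T i); apply: null_keep; rewrite ?setU1T// !inE eqxx.
have : null finset.setT (z - dpush (keep i) 0 z).
  rewrite (@eq_dpush (keep i) 0 (fun k => if k \in enum (predC1 i) then 0 else 1) 0)//.
    by apply: kill_seq => k; rewrite mem_enum => /zp.
  by move=> k; rewrite mem_enum inE /keep; case: eqP.
by move=> /nullD/(_ zi); rewrite subrK.
Qed.

End DiagonalMaps.

(** The same with rational coefficients. *)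
Ltac chain_lra := apply/eqP/freeg_eqP => ?;
  rewrite ?(coeffB, coeffD, coeffN, coeffMn, coeffZ); lra.

(** * Invariant classes of the torus *)

Section SignInvariants.
Variables (R : realType) (n : nat).
Local Notation V := 'cV[R]_n.
Local Notation chain := (chain rat R V).
Local Notation bd := (boundary rat R V).
Local Notation Z := (lattice_zero (finset.setT : {set 'I_n})).
Local Notation N := (null (finset.setT : {set 'I_n})).
Local Notation r k := (dpush (flip R k) 0).
Local Notation p k := (dpush (kill R k) 0).

Lemma flip_killT k j (z : chain j.+1) : Z (bd j.+1 z) ->
  N (z + r k z - p k z *+ 2).
Proof.
by rewrite -(setU1T k) => zZ; apply: flip_kill => //; rewrite !inE eqxx.
Qed.

Lemma boundary_dpushT d b j (z : chain j) :
  (forall k, d k \is a Num.int) -> Z (bd j z) -> Z (bd j (dpush d b z)).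
Proof. by move=> dZ zZ; rewrite boundary_dpush; exact: lattice_zero_dpush. Qed.

(** From z + r z = 2 p z and r z = z. *)
Lemma kill_of_flip k j (z : chain j.+1) : Z (bd j.+1 z) ->
  N (z - r k z) -> N (z - p k z).
Proof.
move=> /(flip_killT k) zk /(nullD zk)/(nullZ 2^-1); congr null.
by chain_lra.
Qed.

(** On classes, r_k = 2 p_k - 1 and r_l = 2 p_l - 1, so r_k r_l z = z reads
    2 p_k p_l z = p_k z + p_l z.  Applying p_k gives p_k p_l z = p_k z, and by
    symmetry p_k z = p_l z; then (1 - p_k)(1 - p_l) z = 0 becomes z = p_k z. *)
Lemma kill_of_flip2 k l (z : chain 1) : l != k -> Z (bd 1 z) ->
  N (z - r k (r l z)) -> N (z - p k z).
Proof.
move=> lk zZ I.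
have F1 := flip_killT k zZ.
have F2 := null_dpush 0 (fun i _ => flip_int R k i) (flip_killT l zZ).
have F3 : N (p l z + r k (p l z) - p k (p l z) *+ 2).
  by apply: flip_killT; apply: boundary_dpushT => // i; exact: kill_int.
rewrite !(dpushD, dpushN, dpushMn) in F2.
have H : N (p k (p l z) *+ 4 - p k z *+ 2 - p l z *+ 2).
  have := nullB (nullB F1 (nullZ 2 F3)) (nullD I F2); congr null.
  by chain_lra.
have H' : N (p k (p l z) - p k z).
  have := nullZ 2^-1 (null_dpush 0 (fun i _ => kill_int R k i) H).
  rewrite !(dpushD, dpushN, dpushMn) !kill_kill; congr null.
  by chain_lra.
have E : N ((z - p l z) - p k (z - p l z)).
  rewrite -(setU1T k); apply: null_kill_kill1; rewrite ?setU1T// !inE eqxx//.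
rewrite dpushB in E.
have := nullD E (nullD (nullZ (- 2^-1) H) H'); congr null.
by chain_lra.
Qed.

Lemma null_of_flips i j (z : chain j.+2) : Z (bd j.+2 z) ->
  (forall k, k != i -> N (z - r k z)) -> N z.
Proof.
move=> zZ zr; apply: (null_of_kill_but_one zZ (i := i)) => k ki.
exact/kill_of_flip/zr.
Qed.

Lemma null1_of_flips (S : {set 'I_n}) (z : chain 1) : Z (bd 1 z) ->
  (forall k, k \notin S -> N (z - r k z)) ->
  (forall k, k \in S -> exists2 l, l != k & N (z - r k (r l z))) -> N z.
Proof.
move=> zZ zr zS; apply: (null_of_kill zZ) => k.
have [/zS[l lk zkl]|/zr zk] := boolP (k \in S).
  exact: kill_of_flip2 zkl.
exact: kill_of_flip.
Qed.

End SignInvariants.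

(** * Lifting simplices through a covering *)

Section Contraction.
Variables (R : realType) (j : nat).
Local Notation D := (simplex R j).

Definition clamp (t : R) : R := Num.max 0 (Num.min t 1).

Lemma clamp_ge0 t : 0 <= clamp t.
Proof. by rewrite /clamp le_max lexx. Qed.

Lemma clamp_le1 t : clamp t <= 1.
Proof. by rewrite /clamp ge_max ler01 ge_min lexx orbT. Qed.

Lemma clamp_id t : 0 <= t <= 1 -> clamp t = t.
Proof. by move=> /andP[t0 t1]; rewrite /clamp min_l// max_r. Qed.

Lemma clamp_lip t t' : `|clamp t - clamp t'| <= `|t - t'|.
Proof.
wlog tt' : t t' / t <= t'.
  move=> H; have [/H//|/ltW/H] := leP t t'.
  by rewrite distrC (distrC t).
rewrite (ler0_norm (_ : t - t' <= 0)) ?subr_le0//.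
rewrite /clamp /Num.max /Num.min.
do ![case: ifPn]; rewrite -?leNgt => *; rewrite ler_norml; apply/andP; split; lra.
Qed.

Lemma contract_in t (x : D) :
  clamp t *: bary x + (1 - clamp t) *: vertex0_row R j \in @simplex_set R j.
Proof.
have [x0 x1] := baryP x; have [v0 v1] := set_mem (@vertex0_in R j).
apply/mem_set; split=> [i|].
  by rewrite !mxE addr_ge0// mulr_ge0 ?clamp_ge0// ?subr_ge0 ?clamp_le1// ler0n.
rewrite (eq_bigr (fun i => clamp t * bary x 0 i + (1 - clamp t) * vertex0_row R j 0 i)).
  by rewrite big_split -!mulr_sumr /= v1 x1 !mulr1 addrC subrK.
by move=> i _; rewrite !mxE.
Qed.

(** The contraction of the simplex onto vertex 0, with the time clamped to
    [0, 1] so that it is a map of the simplex at all real times. *)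
Definition contract t (x : D) : D :=
  exist _ (clamp t *: bary x + (1 - clamp t) *: vertex0_row R j)
    (contract_in t x).

Lemma bary_contract t x :
  bary (contract t x) = clamp t *: bary x + (1 - clamp t) *: vertex0_row R j.
Proof. by []. Qed.

Lemma contract0 x : contract 0 x = vertex0 R j.
Proof.
apply: bary_inj; rewrite bary_contract clamp_id ?lexx ?ler01//.
by rewrite scale0r add0r subr0 scale1r.
Qed.

Lemma contract1 x : contract 1 x = x.
Proof.
apply: bary_inj; rewrite bary_contract clamp_id ?lexx ?ler01//.
by rewrite subrr scale0r addr0 scale1r.
Qed.

Lemma contract_lip t t' x :
  `|bary (contract t x) - bary (contract t' x)| <= `|t - t'|.
Proof.
rewrite !bary_contract; apply: le_trans (clamp_lip t t').
have -> : clamp t *: bary x + (1 - clamp t) *: vertex0_row R j -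
    (clamp t' *: bary x + (1 - clamp t') *: vertex0_row R j) =
    (clamp t - clamp t') *: (bary x - vertex0_row R j).
  by apply/rowP => i; rewrite !mxE; ring.
rewrite normrZ ler_piMr//; apply/mx_norm_leP => // i k.
have [x0 _] := baryP x; have x1 := simplex_le1 x k.
rewrite ord1 !mxE; case: eqP => _ /=; rewrite ler_norml; have := x0 k; lra.
Qed.

Lemma contract_continuous t : continuous (contract t).
Proof.
move=> x A /nbhs_simplexP[e e0 eA]; apply/nbhs_simplexP; exists e => // y xy.
apply: eA; rewrite !bary_contract opprD addrACA subrr addr0 -scalerBr normrZ.
apply: le_lt_trans xy; rewrite ler_piMl// ger0_norm ?clamp_ge0//.
exact: clamp_le1.
Qed.

Lemma contract_continuous_time x : continuous (contract^~ x).
Proof.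
move=> t A /nbhs_simplexP[e e0 eA]; apply/nbhs_ballP; exists e => // t' tt'.
by apply: eA; apply: le_lt_trans tt'; exact: contract_lip.
Qed.

End Contraction.

Lemma continuous_dist (T : topologicalType) (R : realType) (V : normedModType R)
    (f g : T -> V) :
  continuous f -> continuous g -> continuous (fun x => `|f x - g x|).
Proof.
by move=> cf cg x; apply: cvg_norm; apply: cvgB; [exact: cf|exact: cg].
Qed.

(** The hypotheses on [q] hold for the orbit map of a group of isometries whose
    orbits are [r]-separated.  They express, without charts, that balls of
    radius less than r/2 are evenly covered, uniformly on the space. *)
Section Lifting.
Variables (R : realType) (V : normedModType R) (X : topologicalType).
Variables (q : continuousType V X) (r : R).
Hypothesis r0 : 0 < r.
Hypothesis q_open : forall U : set V, open U -> open (q @` U).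
Hypothesis q_surj : forall p, exists y, q y = p.
Hypothesis q_gap : forall y y', q y = q y' -> y = y' \/ r <= `|y - y'|.
Hypothesis q_homog : forall y y' z, q y = q y' ->
  exists2 z', q z' = q z & `|y' - z'| = `|y - z|.

(** Points of the base at distance less than [rho], for the distance between
    fibres. *)
Definition near_fibres (rho : R) (p p' : X) : Prop :=
  exists y y', [/\ q y = p, q y' = p' & `|y - y'| < rho].

Lemma near_fibres_at rho y p : near_fibres rho (q y) p ->
  exists2 y', q y' = p & `|y - y'| < rho.
Proof.
move=> [z [z' [qz qz' zz']]]; have [w qw yw] := q_homog z' qz.
by exists w; [rewrite qw|rewrite yw].
Qed.

Lemma nbhs_image (y : V) (e : R) : 0 < e ->
  nbhs (q y) (q @` [set z | `|y - z| < e]).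
Proof.
move=> e0; apply: open_nbhs_nbhs; split; last first.
  by exists y => //=; rewrite subrr normr0.
apply: q_open; rewrite -[X in open X]/(ball_ Num.norm y e) ball_normE.
exact: ball_open.
Qed.

(** If the map [f] upstairs lies over a map uniformly close to [g], the point
    of the fibre of [g x] close to [f x] is unique and depends continuously on
    [x]. *)
Lemma lift_step (T : topologicalType) (f : T -> V) (g : T -> X) (rho : R) :
  0 < rho -> rho *+ 4 <= r -> continuous f -> continuous g ->
  (forall x, near_fibres rho (q (f x)) (g x)) ->
  exists2 f' : T -> V, continuous f' & forall x, q (f' x) = g x.
Proof.
move=> rho0 rho4 cf cg fg.
have /choice[f' f'P] : forall x, exists y, q y = g x /\ `|f x - y| < rho.
  by move=> x; have [y] := near_fibres_at (fg x); exists y.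
exists f'; last by move=> x; have [] := f'P x.
move=> x; apply/continuous_at_normP => e e0.
pose d := Num.min e rho; have d0 : 0 < d by rewrite lt_min e0.
have gx : \forall z \near x, (q @` [set y | `|f' x - y| < d]) (g z).
  by apply: cg; rewrite -(f'P x).1; exact: nbhs_image.
have fx := (continuous_at_normP f x).1 (cf x) rho rho0.
apply: filterS2 gx fx => z [y /= yd qy] fxz.
have [de dr] : d <= e /\ d <= rho by rewrite /d !ge_min !lexx orbT.
have [qz fz] := f'P z; have [_ f'x] := f'P x.
suff -> : f' z = y by exact: lt_le_trans de.
have [] : f' z = y \/ r <= `|f' z - y| by apply: q_gap; rewrite qz.
  by [].
move=> ry; exfalso; suff : `|f' z - y| < r by rewrite ltNge ry.
apply: le_lt_trans (ler_distD (f x) _ _) _.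
have := ler_distD (f z) (f' z) (f x); have := ler_distD (f' x) (f x) y.
have : `|f' z - f z| < rho by rewrite distrC.
have : `|f z - f x| < rho by rewrite distrC.
lra.
Qed.

Section LiftSimplex.
Variables (j : nat).
Local Notation D := (simplex R j).

(** The Lebesgue number lemma for the simplex, the sets being the preimages of
    small balls of the base. *)
Lemma uniformly_near (s : continuousType D X) (rho : R) : 0 < rho ->
  exists2 d : R, 0 < d & forall x y : D, `|bary x - bary y| < d ->
    near_fibres rho (s x) (s y).
Proof.
move=> rho0.
have := (compact_near_coveringP _).1 (@simplex_compact R j).
move=> /(_ _ (0 : R)^'+ (fun d x => forall y : D, `|bary x - bary y| < d ->
    near_fibres rho (s x) (s y)) _).
have H : forall x : D, [set: D] x -> \forall x' \near x & d \near (0 : R)^'+,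
    forall y : D, `|bary x' - bary y| < d -> near_fibres rho (s x') (s y).
  move=> x _; have [y0 qy0] := q_surj (s x).
  have : nbhs x (s @^-1` (q @` [set z | `|y0 - z| < rho / 2])).
    by apply: (@cts_fun _ _ s); rewrite -qy0; apply: nbhs_image; rewrite divr_gt0.
  move=> /nbhs_simplexP[e e0 eP].
  exists ([set x' | `|bary x - bary x'| < e / 2], [set d | d < e / 2]).
    split=> /=; last by apply: nbhs_right_lt; rewrite divr_gt0.
    by apply/nbhs_simplexP; exists (e / 2); rewrite ?divr_gt0.
  move=> [x' d] /= [xx' de] y x'y.
  have [z /= yz qz] : (q @` [set z | `|y0 - z| < rho / 2]) (s x').
    by apply: eP; apply: lt_trans xx' _; lra.
  have [z' /= yz' qz'] : (q @` [set z | `|y0 - z| < rho / 2]) (s y).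
    apply: eP; apply: le_lt_trans (ler_distD (bary x') _ _) _; lra.
  exists z, z'; split=> //; apply: le_lt_trans (ler_distD y0 _ _) _.
  rewrite distrC; lra.
move=> /(_ H) [e e0 eP].
have e20 : 0 < e / 2 by rewrite divr_gt0.
exists (e / 2) => // x y xy; apply: (eP (e / 2) _ _ x) => //=.
by rewrite sub0r normrN gtr0_norm//; lra.
Qed.

(** The simplex is deformed from a constant map in [N] steps, each small enough
    for [lift_step]. *)
Lemma lift_exists (s : singular_simplex R X j) :
  exists s' : singular_simplex R V j, push_simplex q s' = s.
Proof.
pose rho := r / 4; have rho0 : 0 < rho by rewrite divr_gt0.
have [d d0 dP] := uniformly_near s rho0.
have [N N0 Nd] : exists2 N : nat, (0 < N)%N & N%:R^-1 < d.
  exists (Num.bound d^-1).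
    rewrite -(ltr0n R); apply: le_lt_trans (archi_boundP _);
      by rewrite invr_ge0 ltW.
  have bd : d^-1 < (Num.bound d^-1)%:R.
    by apply: archi_boundP; rewrite invr_ge0 ltW.
  by rewrite invf_plt// posrE (lt_trans _ bd)// invr_gt0.
have step k : (k <= N)%N -> exists2 f : D -> V, continuous f &
    forall x, q (f x) = s (contract (k%:R / N%:R) x).
  elim: k => [_|k IH kN].
    have [y qy] := q_surj (s (vertex0 R j)).
    exists (cst y); first exact: cst_continuous.
    by move=> x; rewrite mul0r contract0.
  have [f cf qf] := IH (ltnW kN).
  apply: (lift_step (rho := rho) (f := f)) => //.
  - by rewrite /rho; lra.
  - move=> x; apply: (@continuous_comp _ _ _ (contract (k.+1%:R / N%:R)) s).
      exact: contract_continuous.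
    exact: cts_fun.
  - move=> x; rewrite qf; apply: dP; apply: le_lt_trans Nd.
    apply: le_trans (contract_lip _ _ _) _.
    by rewrite distrC -mulrBl -natrB// subSnn mul1r ger0_norm// invr_ge0.
have [f cf qf] := step N (leqnn N).
exists (mkcts cf : continuousType D V); apply/continuousEP => x.
by rewrite /= /mkcts qf divff ?contract1// pnatr_eq0 -lt0n.
Qed.

(** Along the contraction onto vertex 0, the distance of two lifts is
    continuous and is either zero or at least [r]. *)
Lemma lift_unique (s s' : singular_simplex R V j) :
  push_simplex q s = push_simplex q s' ->
  s (vertex0 R j) = s' (vertex0 R j) -> s = s'.
Proof.
have [r20 r2r] : 0 < r / 2 /\ r / 2 < r.
  by rewrite divr_gt0// ltr_pdivrMr// ltr_pMr// ltr1n.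
move=> /continuousEP qss' ss'0; apply/continuousEP => x.
have gap y : s y = s' y \/ r <= `|s y - s' y| by apply: q_gap; exact: qss'.
have [//|rx] := gap x; exfalso.
pose phi t := `|s (contract t x) - s' (contract t x)|.
have cphi : continuous phi.
  have cs (u : singular_simplex R V j) : continuous (u \o (fun t => contract t x)).
    move=> t; apply: continuous_comp; first exact: contract_continuous_time.
    exact: cts_fun.
  exact: (continuous_dist (cs s) (cs s')).
have phi0 : phi 0 = 0 by rewrite /phi contract0 ss'0 subrr normr0.
have phi1 : phi 1 = `|s x - s' x| by rewrite /phi contract1.
have [t _] : exists2 t, t \in `[0 : R, 1] & phi t = r / 2.
  apply: IVT; [exact: ler01|exact: continuous_subspaceT|].
  rewrite phi0 phi1 min_l ?normr_ge0// max_r ?normr_ge0//.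
  by rewrite (ltW r20) (le_trans (ltW r2r)).
rewrite /phi; have [->|rt] := gap (contract t x) => ht.
  by move: r20; rewrite -ht subrr normr0 ltxx.
by move: r2r; rewrite -ht ltNge rt.
Qed.

End LiftSimplex.
End Lifting.

(** * Transfer for the quotient by a group of diagonal motions *)

(** Here [q] is the orbit map of a group acting by [deck g], with coefficients
    of absolute value one, which contains the translations by the basis
    vectors.  The map [phi], with values in a finite type, tells the cosets of
    the lattice Z^n apart, so that Z^n has finite index. *)
Section FlatQuotient.
Variables (R : realType) (n : nat) (X : topologicalType).
Local Notation V := 'cV[R]_n.
Variables (q : continuousType V X) (r : R).
Hypothesis r_gt0 : 0 < r.
Hypothesis q_open : forall U : set V, open U -> open (q @` U).
Hypothesis q_surj : forall p, exists y, q y = p.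
Hypothesis q_gap : forall y y', q y = q y' -> y = y' \/ r <= `|y - y'|.

Variables (gT : groupType) (sgn : gT -> 'I_n -> R) (tra : gT -> V).
Local Notation deck g := (diag_map (sgn g) (tra g)).
Hypothesis sgn_pm1 : forall g k, sgn g k = 1 \/ sgn g k = -1.
Hypothesis deckM : forall g h y, deck (g * h)%g y = deck g (deck h y).
Hypothesis deck1 : forall y, deck 1%g y = y.
Hypothesis q_deck : forall y y', q y = q y' <-> exists g, y' = deck g y.
Hypothesis deck_basis : forall k, exists g, forall y, deck g y = y + basis_vector k.

Variables (T : finType) (phi : gT -> T).
Hypothesis phiP : forall g h, phi g = phi h <->
  exists2 u, lattice_vector finset.setT u & forall y, deck h y = deck g y + u.

Local Notation Z := (lattice_zero (finset.setT : {set 'I_n})).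
Local Notation N := (null (finset.setT : {set 'I_n})).

Lemma deck_isometry g y y' : `|deck g y - deck g y'| = `|y - y'|.
Proof.
have E k : `|(deck g y - deck g y') k 0| = `|(y - y') k 0|.
  rewrite /= /mkcts /diag_fun !mxE opprD addrACA subrr addr0 -mulrBr normrM.
  by have [->|->] := sgn_pm1 g k; rewrite ?normrN normr1 mul1r.
apply/eqP; rewrite eq_le; apply/andP; split; apply/mx_norm_leP => // k i.
  by rewrite ord1 E; exact: mx_entry_le.
by rewrite ord1 -E; exact: mx_entry_le.
Qed.

Lemma q_homogeneous y y' z : q y = q y' ->
  exists2 z', q z' = q z & `|y' - z'| = `|y - z|.
Proof.
move=> /q_deck[g ->]; exists (deck g z); last exact: deck_isometry.
by apply/esym/q_deck; exists g.
Qed.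

Lemma q_invariant g y : q (deck g y) = q y.
Proof. by apply/esym/q_deck; exists g. Qed.

Lemma push_q_deck g j (c : chain rat R V j) : push q (push (deck g) c) = push q c.
Proof. by apply: push_comp => y; rewrite /= q_invariant. Qed.

Definition lift_simplex j (s : singular_simplex R X j) :
    singular_simplex R V j :=
  projT1 (cid (lift_exists r_gt0 q_open q_surj q_gap q_homogeneous s)).

Lemma lift_simplexK j (s : singular_simplex R X j) :
  push_simplex q (lift_simplex s) = s.
Proof. by rewrite /lift_simplex; case: cid. Qed.

Definition lift_chain j : {linear chain rat R X j -> chain rat R V j} :=
  chain_ext (fun s => gen (lift_simplex s)).

Lemma lift_chainK j (c : chain rat R X j) : push q (lift_chain j c) = c.
Proof.
rewrite -[LHS]/((push q \o lift_chain j) c) -[RHS]/(idfun c).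
apply: linear_chain_eq => s.
rewrite -[LHS]/(push q (lift_chain j (gen s))).
by rewrite [lift_chain _ _]chain_extU pushU lift_simplexK.
Qed.

(** The chains of the quotient are the coinvariants of the chains upstairs, as
    two lifts of a simplex differ by a deck transformation. *)
Lemma push_q_kernel j (P : chain rat R V j -> Prop) : P 0 ->
  (forall a c d, P c -> P d -> P (a *: c + d)) ->
  (forall g s, P (push (deck g) (gen s) - gen s)) ->
  forall c, push q c = 0 -> P c.
Proof.
move=> P0 PD Pg c qc0; suff : P (c - lift_chain j (push q c)).
  by rewrite qc0 linear0 subr0.
elim/chain_ind: c {qc0} => [|a s c IH]; first by rewrite !(linear0, addr0).
have -> : a *: gen s + c - lift_chain j (push q (a *: gen s + c)) =
    a *: (gen s - lift_chain j (push q (gen s))) + (c - lift_chain j (push q c)).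
  rewrite [push q _]linearP [lift_chain _ _]linearP opprD addrACA.
  by rewrite -scalerBr.
apply: (PD) => //; rewrite pushU [lift_chain _ _]chain_extU.
set s' := lift_simplex _; have qs' : push_simplex q s' = push_simplex q s.
  exact: lift_simplexK.
have [g gs] : exists g, s' (vertex0 R j) = deck g (s (vertex0 R j)).
  by apply/q_deck; have /continuousEP/(_ (vertex0 R j)) := qs'.
have -> : s' = push_simplex (deck g) s.
  apply: (lift_unique r_gt0 q_gap) => //; rewrite qs'.
  by apply/continuousEP => x; rewrite /= q_invariant.
have := PD (-1) _ _ (Pg g s) P0; congr P.
by rewrite scaleN1r addr0 opprB pushU.
Qed.

Lemma deck_congr g h j (c : chain rat R V j) : phi g = phi h ->
  Z (push (deck g) c - push (deck h) c).
Proof.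
move=> /phiP[u uT gh]; rewrite -opprB; apply: lattice_zeroN.
have -> : push (deck h) c = tpush u (push (deck g) c).
  by apply/esym/push_comp => y; rewrite gh.
exact: lattice_zero_tpush.
Qed.

Lemma phi_mulr g g' h : phi (g * h)%g = phi (g' * h)%g -> phi g = phi g'.
Proof.
move=> /phiP[u uT gh]; apply/phiP; exists u => // y.
by have := gh (deck h^-1%g y); rewrite !deckM -(deckM h) mulgV deck1.
Qed.

Lemma phi_mull g g' h : phi (h * g)%g = phi (h * g')%g -> phi g = phi g'.
Proof.
move=> /phiP[u uT gh]; apply/phiP.
exists (\col_k (sgn h^-1%g k * u k 0)) => [k|y].
  rewrite mxE inE; split=> //; apply: rpredM; last by have [] := uT k.
  by have [->|->] := sgn_pm1 h^-1%g k; rewrite ?rpredN rpred1.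
have := gh y; rewrite !(deckM h) => /(congr1 (deck h^-1%g)).
rewrite [X in _ = X -> _]diag_mapD.
by rewrite -!(deckM h^-1%g) mulVg !deck1.
Qed.

Definition cosets : {set T} := [set t | `[< exists g, phi g = t >]]%SET.

Lemma phi_cosets g : phi g \in cosets.
Proof. by rewrite inE; apply/asboolP; exists g. Qed.

Lemma cosets_rep t : exists g, t \in cosets -> phi g = t.
Proof.
case: (boolP (t \in cosets)) => [|_]; last by exists 1%g.
by rewrite inE => /asboolP[g gt]; exists g.
Qed.

Definition rep t : gT := projT1 (cid (cosets_rep t)).

Lemma repP t : t \in cosets -> phi (rep t) = t.
Proof. by rewrite /rep; case: cid. Qed.

(** The sum over the cosets of Z^n of the images under the group.  It depends
    on the representatives only modulo [lattice_zero]. *)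
Definition transfer j : chain rat R V j -> chain rat R V j :=
  fun c => \sum_(t in cosets) push (deck (rep t)) c.

(** The map induced by [f] on the finite set of cosets is injective, hence a
    permutation. *)
Lemma transfer_congr (f : gT -> gT) j (c : chain rat R V j) :
  (forall g g', phi (f g) = phi (f g') -> phi g = phi g') ->
  Z (\sum_(t in cosets) push (deck (f (rep t))) c - transfer c).
Proof.
move=> f_inj; pose psi t := phi (f (rep t)).
have psi_inj : {in cosets &, injective psi}.
  by move=> t t' tI t'I /f_inj; rewrite !repP.
have psiE : (psi @: cosets)%SET = cosets.
  apply/eqP; rewrite eqEcard (card_in_imset psi_inj) leqnn andbT.
  by apply/fintype.subsetP => _ /imsetP[t _ ->]; exact: phi_cosets.
have -> : transfer c = \sum_(t in cosets) push (deck (rep (psi t))) c.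
  rewrite -[LHS]/(\sum_(t in cosets) push (deck (rep t)) c).
  by rewrite -{1}psiE big_imset.
rewrite -sumrB; apply: lattice_zero_sum => t tI; apply: deck_congr.
by rewrite repP//; exact: phi_cosets.
Qed.

Lemma transferP j a (c d : chain rat R V j) :
  transfer (a *: c + d) = a *: transfer c + transfer d.
Proof.
rewrite /transfer scaler_sumr -big_split /=; apply: eq_bigr => t _.
exact: linearP.
Qed.

Lemma transferB j (c d : chain rat R V j) :
  transfer (c - d) = transfer c - transfer d.
Proof. by rewrite addrC -scaleN1r transferP scaleN1r addrC. Qed.

Lemma boundary_transfer j (c : chain rat R V j) :
  boundary rat R V j (transfer c) = transfer (boundary rat R V j c).
Proof.
by rewrite linear_sum; apply: eq_bigr => t _; exact: boundary_push.
Qed.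

Lemma push_deckM g h j (c : chain rat R V j) :
  push (deck g) (push (deck h) c) = push (deck (g * h)%g) c.
Proof. by apply: push_comp => y; rewrite deckM. Qed.

Lemma transfer_push h j (c : chain rat R V j) :
  Z (transfer (push (deck h) c) - transfer c).
Proof.
rewrite {1}/transfer; under eq_bigr do rewrite push_deckM.
by apply: (transfer_congr (f := fun g => (g * h)%g)) => g g' /phi_mulr.
Qed.

Lemma push_transfer h j (c : chain rat R V j) :
  Z (push (deck h) (transfer c) - transfer c).
Proof.
rewrite {1}/transfer linear_sum; under eq_bigr do rewrite push_deckM.
by apply: (transfer_congr (f := fun g => (h * g)%g)) => g g' /phi_mull.
Qed.

Lemma push_q_transfer j (c : chain rat R V j) :
  push q (transfer c) = push q c *+ #|cosets|.
Proof.
rewrite /transfer linear_sum -sumr_const; apply: eq_bigr => t _.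
exact: push_q_deck.
Qed.

Lemma transfer_cycle j (z : chain rat R X j) :
  boundary rat R X j z = 0 ->
  Z (boundary rat R V j (transfer (lift_chain j z))).
Proof.
move=> z0; rewrite boundary_transfer.
apply: (push_q_kernel (P := fun c => Z (transfer c))).
- rewrite -[X in transfer X](subrr 0) transferB subrr; exact: lattice_zero0.
- move=> a c d cZ dZ; rewrite transferP; apply: lattice_zeroD => //.
  exact: lattice_zeroZ.
- by move=> g s; rewrite transferB; exact: transfer_push.
- by rewrite -boundary_push lift_chainK.
Qed.

Lemma push_q_lattice_zero j (c : chain rat R V j) : Z c -> push q c = 0.
Proof.
move=> [y ->]; rewrite linear_sum big1// => k _.
have [g gk] := deck_basis k.
rewrite linearB [X in X - _](_ : _ = push q (y k)) ?subrr//.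
by apply: push_comp => v; rewrite /= /mkcts -gk q_invariant.
Qed.

(** If the transfer [w] of a lift of the cycle [z] is the boundary of [b] modulo
    [lattice_zero], then [push q b] bounds [push q w], which is [z] times the
    index of the lattice.  That [w] is a cycle invariant under the group, up to
    boundaries, comes from [transfer_push] and [push_transfer].  Only the signs
    appear in the hypothesis, since translations are homotopic to the
    identity. *)
Lemma boundary_of_null j (z : chain rat R X j) : boundary rat R X j z = 0 ->
  (forall w : chain rat R V j, Z (boundary rat R V j w) ->
    (forall g, N (w - dpush (sgn g) 0 w)) -> N w) ->
  exists b, boundary rat R X j.+1 b = z.
Proof.
move=> z0 H; set w := transfer (lift_chain j z).
have wZ : Z (boundary rat R V j w) by exact: transfer_cycle.
have [g|b wb] := H w wZ.
  have /nullN wg := null_lattice_zero (push_transfer g (lift_chain j z)).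
  have : N (dpush (sgn g) (tra g) w - dpush (sgn g) 0 w).
    apply: null_dpush_sub => // k _; split=> //.
    by have [->|->] := sgn_pm1 g k; rewrite ?rpredN rpred1.
  by move=> /(nullD wg); rewrite opprB addrA subrK.
have := push_q_lattice_zero wb.
rewrite linearB push_q_transfer lift_chainK => /eqP; rewrite subr_eq0 => /eqP E.
exists (#|cosets|%:R^-1 *: push q b); rewrite linearZ boundary_push -E.
rewrite -scaler_nat [LHS]scalerA mulVf ?scale1r// pnatr_eq0.
by rewrite -lt0n; apply/card_gt0P; exists (phi 1%g); exact: phi_cosets.
Qed.

(** The base is path-connected, being an image of the vector space. *)
Lemma boundary_of_augmentation0 (c : chain rat R X 0) :
  augmentation rat R X c = 0 -> exists b, boundary rat R X 1 b = c.
Proof.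
move=> c0; exists (push q (cone_chain rat (0 : V) 0 (lift_chain 0 c))).
rewrite boundary_push boundary_cone0 linearB lift_chainK.
have -> : augmentation rat R V (lift_chain 0 c) = augmentation rat R X c.
  rewrite -[LHS]/((augmentation rat R V \o lift_chain 0) c).
  apply: linear_chain_eq => s.
  rewrite -[LHS]/(augmentation rat R V (lift_chain 0 (gen s))).
  by rewrite [lift_chain _ _]chain_extU !augmentationU.
by rewrite c0 scale0r linear0 subr0.
Qed.

End FlatQuotient.

(** * Homology modules *)

Section HomologyFacts.

Section Class.
Variables (K : nzRingType) (U V W : lmodType K).
Variables (f : {linear U -> V}) (g : {linear V -> W}).

Definition homology_class (x : ker_lmod g) : homology f g :=
  \pi_(Quotient.quot (@im_in_ker K U V W f g)) x.
Local Notation cls := homology_class.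

Lemma homology_classP (x y : ker_lmod g) :
  cls x = cls y <-> exists u, f u = val x - val y.
Proof.
have E : (cls x == cls y) = (x - y \in @im_in_ker K U V W f g).
  by rewrite /homology_class piE Quotient.equivE.
have -> : val x - val y = val (x - y) by rewrite raddfB.
have Q : (x - y \in @im_in_ker K U V W f g) =
  `[< exists u, f u = val (x - y) >] by [].
rewrite Q in E; split=> [/eqP|ex]; first by rewrite E => /asboolP.
by apply/eqP; rewrite E; apply/asboolP.
Qed.

Lemma homology_class_repr (h : homology f g) : cls (repr h) = h.
Proof. exact: reprK. Qed.

Lemma homology_class_linear a x y : cls (a *: x + y) = a *: cls x + cls y.
Proof.
rewrite /cls -[RHS]/(homology_scale a _ + _) -pi_homology_scale.
by rewrite !piE.
Qed.

Lemma homology_class0 : cls 0 = 0.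
Proof. by rewrite /cls !piE. Qed.

Lemma homology_classZ a x : cls (a *: x) = a *: cls x.
Proof. by rewrite /homology_class pi_homology_scale. Qed.

Lemma homology_eq0 :
  (forall z, g z = 0 -> exists u, f u = z) -> forall h : homology f g, h = 0.
Proof.
move=> fg h; rewrite -(homology_class_repr h) -homology_class0.
apply/homology_classP; rewrite subr0; apply: fg.
exact/eqP/(valP (repr h)).
Qed.

Lemma homology_iso (a : {linear V -> K^o}) :
  (forall u, a (f u) = 0) ->
  (forall z, g z = 0 -> a z = 0 -> exists u, f u = z) ->
  (exists2 z, g z = 0 & a z = 1) -> lmod_iso (homology f g) K^o.
Proof.
move=> af a0 [z1 gz1 az1].
pose F (h : homology f g) : K^o := a (val (repr h : ker_lmod g)).
have FE (x : ker_lmod g) : F (cls x) = a (val x).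
  have /homology_classP[u fu] := homology_class_repr (cls x).
  by have := af u; rewrite fu linearB => /eqP; rewrite subr_eq0 => /eqP.
have Flin : linear F.
  move=> k x y; rewrite -(homology_class_repr x) -(homology_class_repr y).
  by rewrite -homology_class_linear !FE -linearP.
pose FL := GRing.isLinear.Build K (homology f g) K^o _ F Flin.
pose Fl : {linear homology f g -> K^o} := HB.pack F FL.
have kerP z : g z = 0 -> z \in ker_pred g by move=> gz; rewrite inE gz.
pose z := KerLmod (kerP _ gz1).
have vZ k (y : ker_lmod g) : val (k *: y) = k *: val y by exact: linearZ.
exists Fl; exists (fun k => k *: cls z) => [h|k]; last first.
  rewrite -homology_classZ [LHS]FE vZ linearZ /= az1.
  exact: mulr1.
rewrite -(homology_class_repr h); set x := repr h; rewrite [Fl _]FE.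
rewrite -homology_classZ; apply/homology_classP; rewrite vZ; apply: a0.
  rewrite linearB linearZ /= gz1 scaler0 sub0r.
  by rewrite (eqP (valP x)) oppr0.
by rewrite linearB linearZ /= az1 -[_ *: 1]/(_ * 1) mulr1 subrr.
Qed.

End Class.

Lemma lmod_iso_trans (K : nzRingType) (U V W : lmodType K) :
  lmod_iso U V -> lmod_iso V W -> lmod_iso U W.
Proof.
move=> [f fb] [g gb]; exists (g \o f); exact: bij_comp.
Qed.

Lemma rV1_iso (K : nzRingType) : lmod_iso 'rV[K]_1 K^o.
Proof.
have lin : linear (fun v : 'rV[K]_1 => v 0 0 : K^o).
  by move=> a u v; rewrite !mxE.
pose L := GRing.isLinear.Build K 'rV[K]_1 K^o _ _ lin.
pose f : {linear 'rV[K]_1 -> K^o} := HB.pack (fun v : 'rV[K]_1 => v 0 0 : K^o) L.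
exists f; exists (fun x => const_mx x) => [v|x] /=; last by rewrite mxE.
by apply/rowP => i; rewrite !mxE (ord1 i).
Qed.

Lemma rV1_neq0 (K : nzRingType) (V : lmodType K) : lmod_iso V 'rV[K]_1 ->
  ~ forall v : V, v = 0.
Proof.
move=> [f [g _ gK]] V0; have := gK (const_mx 1).
rewrite (V0 (g _)) linear0 => /rowP/(_ 0)/eqP.
by rewrite !mxE eq_sym oner_eq0.
Qed.

End HomologyFacts.

(** * The translation lattice and the holonomy *)

Lemma continuous_fsum (T : topologicalType) (R : realType) (I : finType)
    (F : I -> T -> R) x : (forall i, {for x, continuous (F i)}) ->
  {for x, continuous (fun y => \sum_i F i y)}.
Proof.
move=> cF; elim: (index_enum _) => [|i s IH].
  have -> : (fun y => \sum_(i <- [::]) F i y) = cst 0.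
    by apply/funext => y; rewrite big_nil.
  exact: cst_continuous.
have -> : (fun y => \sum_(k <- i :: s) F k y) =
    (fun y => F i y + \sum_(k <- s) F k y).
  by apply/funext => y; rewrite big_cons.
by apply: continuousD.
Qed.

Lemma continuous_entry (T : topologicalType) (R : realType) m n
    (f : T -> 'M[R]_(m, n)) i j :
  continuous f -> continuous (fun x => f x i j).
Proof.
move=> cf x.
exact: (@continuous_comp _ _ _ f (fun A : 'M[R]_(m, n) => A i j) x (cf x)
  (@coord_continuous _ _ _ i j (f x))).
Qed.

Lemma continuous_fst (T X Y : topologicalType) (f : T -> X * Y) :
  continuous f -> continuous (fun x => (f x).1).
Proof. by move=> cf x; exact: (continuous_comp (cf x) cvg_fst). Qed.

Lemma continuous_snd (T X Y : topologicalType) (f : T -> X * Y) :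
  continuous f -> continuous (fun x => (f x).2).
Proof. by move=> cf x; exact: (continuous_comp (cf x) cvg_snd). Qed.

Lemma continuous_normr (T : topologicalType) (R : realType) (f : T -> R) :
  continuous f -> continuous (fun x => `|f x|).
Proof. by move=> cf x; apply: cvg_norm; exact: cf. Qed.

(** A set spans when no nonzero functional vanishes on it.  This criterion suits
    lattices, for which functionals are easier to control than dimensions. *)
Lemma basis_from_spanning (F : fieldType) n (S : 'cV[F]_n -> Prop) :
  (forall l : 'rV[F]_n, (forall x, S x -> l *m x = 0) -> l = 0) ->
  exists W : 'M[F]_n, W \in unitmx /\ forall k, S (col k W).
Proof.
move=> Sspan.
have step k : (k <= n)%N -> exists W : 'M[F]_(n, k),
    \rank W = k /\ forall i, S (col i W).
  elim: k => [_|k IH kn].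
    by exists 0; rewrite mxrank0; split=> // -[].
  have [W [rW SW]] := IH (ltnW kn).
  have : kermx W != 0 by rewrite kermx_eq0 /row_free rW neq_ltn kn.
  move=> /matrix0Pn[i [j Wij]].
  pose l := row i (kermx W).
  have lW : l *m W = 0 by rewrite -row_mul mulmx_ker row0.
  have l0 : l != 0 by apply: contraNneq Wij => /rowP/(_ j); rewrite !mxE => ->.
  have [x Sx lx] : exists2 x, S x & l *m x != 0.
    apply: contrapT => H; move/eqP: l0; apply; apply: Sspan => x Sx.
    by apply/eqP; apply: contrapT => /negP lx; apply: H; exists x.
  have Scol (c : 'I_(1 + k)) : S (col c (row_mx x W)).
    case: (split_ordP c) => d ->; last by rewrite colKr.
    by rewrite colKl (ord1 d) (_ : col 0 x = x)//; apply/colP => r; rewrite mxE.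
  exists (row_mx x W : 'M[F]_(n, 1 + k)); split=> [|c]; last exact: Scol.
  apply/eqP; rewrite eqn_leq rank_leq_col /= -[X in (X < _)%N]rW.
  rewrite -(mxrank_tr W) -(mxrank_tr (row_mx x W)) tr_row_mx ltn_neqAle.
  have WxW : (W^T <= col_mx x^T W^T)%MS by rewrite -addsmxE addsmxSr.
  rewrite mxrankS// andbT (mxrank_leqif_sup WxW).
  apply: contra lx; rewrite col_mx_sub => /andP[/submxP[D xE] _].
  by rewrite -[x]trmxK xE trmx_mul trmxK mulmxA lW mul0mx.
have [W [rW SW]] := step n (leqnn n); exists W; split=> //.
by rewrite -row_free_unit /row_free rW.
Qed.

Section MotionLattice.
Variables (R : realType) (n : nat) (Gamma : groupClosed (motion R n)).
Local Notation G := (subgroup_of Gamma).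
Local Notation V := 'cV[R]_n.
Implicit Types g h : G.

Definition lin g : 'M[R]_n := linear_part (val g).
Definition trans g : V := translation_part (val g).

Lemma linM g h : lin (g * h)%g = lin g *m lin h. Proof. by []. Qed.
Lemma transM g h : trans (g * h)%g = lin g *m trans h + trans g.
Proof. by []. Qed.
Lemma lin1 : lin 1%g = 1%:M. Proof. by []. Qed.
Lemma trans1 : trans 1%g = 0. Proof. by []. Qed.
Lemma linV g : lin g^-1%g = (lin g)^T. Proof. by []. Qed.
Lemma transV g : trans g^-1%g = - ((lin g)^T *m trans g). Proof. by []. Qed.
Lemma lin_orth g : (lin g)^T *m lin g = 1%:M.
Proof. exact: linear_part_orthogonal. Qed.
Lemma lin_orthC g : lin g *m (lin g)^T = 1%:M.
Proof. exact: linear_part_orthogonalC. Qed.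

Lemma subgroup_eq g h : lin g = lin h -> trans g = trans h -> g = h.
Proof. by move=> lgh tgh; apply: val_inj; exact: motion_eq. Qed.

Definition translation_vector (x : V) : Prop :=
  exists g, lin g = 1%:M /\ trans g = x.

Lemma translation_vector0 : translation_vector 0. Proof. by exists 1%g. Qed.

Lemma translation_vectorD x y :
  translation_vector x -> translation_vector y -> translation_vector (x + y).
Proof.
move=> [g [g1 <-]] [h [h1 <-]]; exists (g * h)%g.
by rewrite linM transM g1 h1 !mul1mx addrC.
Qed.

Lemma translation_vectorN x : translation_vector x -> translation_vector (- x).
Proof.
move=> [g [g1 <-]]; exists (g^-1)%g.
by rewrite linV transV g1 trmx1 mul1mx.
Qed.

Lemma translation_vector_lin g x :
  translation_vector x -> translation_vector (lin g *m x).
Proof.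
move=> [h [h1 <-]]; exists (g * h * g^-1)%g.
rewrite !linM linV h1 mulmx1 lin_orthC; split=> //.
rewrite !transM transV linM h1 mulmx1 mulmxN mulmxA lin_orthC mul1mx.
by rewrite addrCA addNr addr0.
Qed.

Lemma translation_vector_sub g h :
  lin g = lin h -> translation_vector (trans g - trans h).
Proof.
move=> gh; exists (g * h^-1)%g; rewrite linM linV gh lin_orthC; split=> //.
by rewrite transM transV gh mulmxN mulmxA lin_orthC mul1mx addrC.
Qed.

Variable f : holonomy_group Gamma -> 'rV['F_2]_n.-1.
Hypothesis f_bij : bijective f.
Hypothesis fM : forall x y, f (x * y)%g = f x + f y.

Definition holonomy g : 'rV['F_2]_n.-1 :=
  f (\pi_(quotient_group (@translations R n Gamma)) g).

Lemma holonomyM g h : holonomy (g * h)%g = holonomy g + holonomy h.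
Proof.
rewrite /holonomy -fM; congr f.
exact: (@pi_quotient_mul _ (@translations R n Gamma) g h).
Qed.

Lemma holonomy_lin g h : holonomy g = holonomy h <-> lin g = lin h.
Proof.
have E : (\pi_(quotient_group (@translations R n Gamma)) g ==
    \pi_(quotient_group (@translations R n Gamma)) h) = (lin (g^-1 * h)%g == 1%:M).
  by rewrite eq_quotientE.
have [f' fK _] := f_bij.
split=> [/(can_inj fK)/eqP|gh].
  rewrite E linM linV => /eqP /(congr1 (mulmx (lin g))).
  by rewrite mulmxA lin_orthC mul1mx mulmx1.
by congr f; apply/eqP; rewrite E linM linV gh lin_orth.
Qed.

Lemma holonomy_surj v : exists g, holonomy g = v.
Proof.
have [f' _ f'K] := f_bij; exists (repr (f' v)).
by rewrite /holonomy reprK f'K.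
Qed.

Lemma lin_comm g h : lin g *m lin h = lin h *m lin g.
Proof. by rewrite -!linM; apply/holonomy_lin; rewrite !holonomyM addrC. Qed.

Lemma lin_sq g : lin g *m lin g = 1%:M.
Proof.
rewrite -linM -lin1; apply/holonomy_lin; rewrite -[in RHS](mulg1 1%g) !holonomyM.
have addvv (v : 'rV['F_2]_n.-1) : v + v = 0.
  by apply/rowP => i; rewrite !mxE -mulr2n -mulr_natl pchar_Fp_0// mul0r.
by rewrite !addvv.
Qed.

Definition holonomy_rep v : G := projT1 (cid (holonomy_surj v)).

Lemma holonomy_repK v : holonomy (holonomy_rep v) = v.
Proof. by rewrite /holonomy_rep; case: cid. Qed.

Lemma mulmx_continuous m k (B : 'M[R]_(m, k)) :
  continuous (fun x : 'cV[R]_k => B *m x).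
Proof.
move=> x; apply: continuous_mx => i j.
have -> : (fun y : 'cV[R]_k => (B *m y) i j) = (fun y => \sum_l B i l * y l j).
  by apply/funext => y; rewrite mxE.
apply: continuous_fsum => l; apply: continuousM; first exact: cst_continuous.
exact: coord_continuous.
Qed.

Lemma eq_lcosetsP (g h : motion R n) :
  \pi_(quotient_topology (left_cosets Gamma)) g =
  \pi_(quotient_topology (left_cosets Gamma)) h <-> (g^-1 * h \in Gamma)%g.
Proof.
rewrite -[_ = _ <-> _]/(\pi_(left_cosets Gamma) g = \pi_(left_cosets Gamma) h <-> _).
have E : (\pi_(left_cosets Gamma) g == \pi_(left_cosets Gamma) h) =
  (g^-1 * h \in Gamma)%g by rewrite piE.
by rewrite -E; split=> [->|/eqP].
Qed.

Section Cocompact.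
Variable l : 'rV[R]_n.
Hypothesis l_vanishes : forall x, translation_vector x -> l *m x = 0.

(** As [l] vanishes on the translation lattice, its value at [act g x] depends
    only on [x] and on the holonomy of [g].  Summing the absolute values over
    the holonomy gives a continuous function of the orbit of [x]. *)
Definition spread (x : V) : R :=
  \sum_(v : 'rV['F_2]_n.-1) `|(l *m act (val (holonomy_rep v)) x) 0 0|.

Lemma spread_invariant g x : spread (act (val g) x) = spread x.
Proof.
rewrite /spread [RHS](reindex_inj (addIr (holonomy g))); apply: eq_bigr => v _.
rewrite -actM; set h := holonomy_rep v; set h' := holonomy_rep _.
have hh' : lin (h * g)%g = lin h'.
  by apply/holonomy_lin; rewrite holonomyM !holonomy_repK.
have := l_vanishes (translation_vector_sub hh').
rewrite mulmxBr => /eqP; rewrite subr_eq0 => /eqP E.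
rewrite -[(val h * val g)%g]/(val (h * g)%g) /act.
rewrite -!/(lin _) -!/(trans _) hh' mulmxDr [in RHS]mulmxDr.
by rewrite E.
Qed.

Lemma spread_continuous : continuous spread.
Proof.
move=> x; apply: continuous_fsum => v.
have ca : continuous (fun y : V => l *m act (val (holonomy_rep v)) y).
  have -> : (fun y : V => l *m act (val (holonomy_rep v)) y) =
      (fun y : V => (l *m lin (holonomy_rep v)) *m y + l *m trans (holonomy_rep v)).
    by apply/funext => y; rewrite /act mulmxDr mulmxA.
  move=> y; apply: continuousD; last exact: cst_continuous.
  exact: mulmx_continuous.
have cc := continuous_entry (i := 0) (j := 0) ca.
exact: (continuous_normr cc).
Qed.

Lemma spread_ge x : `|(l *m x) 0 0| <= spread x.
Proof.
rewrite /spread (bigD1 0)//; set g := holonomy_rep 0.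
have g1 : lin g = lin 1%g.
  apply/holonomy_lin; rewrite holonomy_repK -(subrr (holonomy 1%g)).
  by rewrite -{1}(mulg1 1%g) holonomyM addrK.
have := l_vanishes (translation_vector_sub g1); rewrite trans1 subr0 => lg.
have -> : l *m act (val g) x = l *m x.
  by rewrite /act -/(lin g) -/(trans g) g1 mul1mx mulmxDr lg addr0.
by rewrite lerDl sumr_ge0.
Qed.

Lemma inverse_translation_continuous :
  continuous (fun g : motion R n => translation_part (g^-1)%g).
Proof.
have c1 : continuous (@motion_pair R n) by exact: initial_continuous.
have cA i j : continuous (fun g : motion R n => linear_part g i j).
  exact: (continuous_entry (continuous_fst c1)).
have ca i : continuous (fun g : motion R n => translation_part g i 0).
  exact: (continuous_entry (continuous_snd c1)).
move=> g; apply: continuous_mx => i j.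
have -> : (fun h : motion R n => (translation_part (h^-1)%g) i j) =
    (fun h : motion R n => - \sum_k linear_part h k i * translation_part h k 0).
  apply/funext => h; rewrite /translation_part /= !mxE; congr (- _).
  by apply: eq_bigr => k _; rewrite !mxE (ord1 j).
apply: continuousN; apply: continuous_fsum => k.
by apply: continuousM; [exact: cA|exact: ca].
Qed.

(** Through g |-> spread (g^-1 0), the invariant function [spread] becomes a
    function on the compact coset space of the group of motions. *)
Lemma cocompact_spread_bounded : cocompact Gamma ->
  exists M : R, forall x, spread x <= M.
Proof.
pose Q := quotient_topology (left_cosets Gamma).
pose F (g : motion R n) := spread (translation_part (g^-1)%g).
have cF : continuous F.
  move=> g; apply: (@continuous_comp _ _ _
    (fun g : motion R n => translation_part (g^-1)%g) spread).
    exact: inverse_translation_continuous.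
  exact: spread_continuous.
have Finv (g h : motion R n) : (g^-1 * h \in Gamma)%g -> F g = F h.
  move=> ghG; pose k : G := SubgroupOf ghG.
  rewrite /F -(spread_invariant k (translation_part (h^-1)%g)); congr spread.
  have -> : (g^-1 = val k * h^-1)%g by rewrite /= mulgK.
  by [].
have cFr : continuous (F \o repr : Q -> R).
  apply: repr_comp_continuous => // g h /eqP gh; apply/eqP/Finv.
  exact/eq_lcosetsP.
move=> cQ; have /compact_bounded[M [_ HM]] : compact ((F \o repr : Q -> R) @` setT).
  by apply: continuous_compact => //; exact: continuous_subspaceT.
exists (`|M| + 1) => x.
pose t := Motion (motion_pair := (1%:M, - x)) (motion_one_subproof R n).
have tE : F t = spread x.
  by rewrite /F /translation_part /= trmx1 mul1mx opprK.
rewrite -tE; have <- : F (repr (\pi_Q t : Q)) = F t.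
  by apply/Finv/eq_lcosetsP; rewrite reprK.
rewrite (le_trans (ler_norm _))//; apply: HM; last by exists (\pi_Q t).
by rewrite (le_lt_trans (ler_norm M))// ltrDl.
Qed.

(** So the translation lattice spans: a bounded linear functional is zero. *)
Lemma cocompact_functional_eq0 : cocompact Gamma -> l = 0.
Proof.
move=> /cocompact_spread_bounded[M HM].
apply/rowP => k; rewrite mxE; apply/eqP; apply: contrapT => /negP lk.
have M0 : 0 <= M by apply: le_trans (HM 0); rewrite sumr_ge0.
have := le_trans (spread_ge (((M + 1) / l 0 k) *: delta_mx k 0)) (HM _).
rewrite -scalemxAr mxE (_ : (l *m delta_mx k 0) 0 0 = l 0 k).
  by rewrite divfK// ger0_norm ?addr_ge0// leNgt ltrDl ltr01.
rewrite mxE (bigD1 k)//= !mxE !eqxx mulr1 big1 ?addr0// => i /negbTE ik.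
by rewrite !mxE ik mulr0.
Qed.

End Cocompact.

Definition eigen_lattice (x : V) : Prop :=
  translation_vector x /\ forall g, lin g *m x = x \/ lin g *m x = - x.

(** The lattice spans, and for an involution A commuting with the others, the
    functional kills x if it kills the eigenvectors x + A x and x - A x of A.
    The elements of the holonomy are treated one after the other. *)
Lemma eigen_lattice_functional_eq0 (l : 'rV[R]_n) : cocompact Gamma ->
  (forall x, eigen_lattice x -> l *m x = 0) -> l = 0.
Proof.
move=> cG; pose P (s : seq G) := forall x, translation_vector x ->
  (forall g, g \in s -> lin g *m x = x \/ lin g *m x = - x) -> l *m x = 0.
suff down s : P s -> P [::].
  move=> H; apply: cocompact_functional_eq0 => // x xL.
  apply: (down [seq holonomy_rep v | v in 'rV['F_2]_n.-1]) => // {}x {}xL xs.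
  apply: H; split=> // g.
  have -> : lin g = lin (holonomy_rep (holonomy g)).
    by apply/holonomy_lin; rewrite holonomy_repK.
  exact/xs/fintype.image_f.
elim: s => // h s IH Ps; apply: IH => x xL xs.
have yP (y : V) : translation_vector y ->
    (forall g, g \in s -> lin g *m y = y \/ lin g *m y = - y) ->
    (lin h *m y = y \/ lin h *m y = - y) -> l *m y = 0.
  move=> yL ys yh; apply: Ps => // g; rewrite inE => /orP[/eqP->//|]; exact: ys.
have hx := translation_vector_lin h xL.
have hs g : g \in s -> (lin g *m x = x /\ lin g *m (lin h *m x) = lin h *m x) \/
    (lin g *m x = - x /\ lin g *m (lin h *m x) = - (lin h *m x)).
  move=> /xs; rewrite mulmxA lin_comm -mulmxA => -[->|->]; first by left.
  by right; rewrite mulmxN.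
have e1 : l *m (x + lin h *m x) = 0.
  apply: yP; first exact: translation_vectorD.
    move=> g /hs[[gx ghx]|[gx ghx]]; rewrite mulmxDr gx ghx; first by left.
    by right; rewrite opprD.
  by left; rewrite mulmxDr mulmxA lin_sq mul1mx addrC.
have e2 : l *m (x - lin h *m x) = 0.
  apply: yP; first by apply: translation_vectorD => //; exact: translation_vectorN.
    move=> g /hs[[gx ghx]|[gx ghx]]; rewrite mulmxBr gx ghx; first by left.
    by right; rewrite opprD.
  by right; rewrite mulmxBr mulmxA lin_sq mul1mx opprB.
have : l *m x *+ 2 = 0.
  have <- : l *m (x + lin h *m x) + l *m (x - lin h *m x) = l *m x *+ 2.
    by rewrite -mulmxDr addrACA subrr addr0 mulmxDr mulr2n.
  by rewrite e1 e2 addr0.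
by move=> /eqP; rewrite -scaler_nat scaler_eq0 pnatr_eq0 /= => /eqP.
Qed.

End MotionLattice.

Section Discrete.
Variables (R : realType) (n : nat) (Gamma : groupClosed (motion R n)).

Lemma discrete_lattice_gap : discrete_subgroup Gamma ->
  exists2 r : R, 0 < r & forall x, translation_vector Gamma x -> `|x| < r -> x = 0.
Proof.
move=> /(_ [set 1%g])[W [B oB BW] WE].
have B1 : nbhs ((1%:M, 0) : 'M[R]_n * 'cV[R]_n) B.
  apply: open_nbhs_nbhs; split=> //.
  have : (@subgroup_val _ Gamma @^-1` W) 1%g by rewrite WE.
  by rewrite /preimage /= -BW.
have [[P Q] /= [P1 Q0] PQB] := B1.
have /nbhs_ballP[r r0 rQ] := Q0.
exists r => // x [g [g1 <-]] xr.
suff -> : g = 1%g by [].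
have : (@subgroup_val _ Gamma @^-1` W) g.
  rewrite /preimage /= -BW /=; apply: PQB; split => /=.
    by rewrite -[(motion_pair _).1]/(lin g) g1; exact: nbhs_singleton.
  by apply: rQ; rewrite -ball_normE /= sub0r normrN.
by rewrite WE.
Qed.

End Discrete.

Lemma mulmx_norm_le (R : realType) m n (W : 'M[R]_(m, n)) :
  exists2 C : R, 0 < C & forall u : 'cV[R]_n, `|W *m u| <= C * `|u|.
Proof.
exists (n%:R * `|W| + 1) => [|u]; first by rewrite ltr_wpDl// mulr_ge0.
apply/mx_norm_leP; first by rewrite mulr_ge0// addr_ge0// mulr_ge0.
move=> i j; rewrite mxE (le_trans (ler_norm_sum _ _ _))//.
apply: (@le_trans _ _ (\sum_(k < n) `|W| * `|u|)).
  apply: ler_sum => k _; rewrite normrM.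
  by apply: ler_pM => //; exact: mx_entry_le.
by rewrite sumr_const card_ord -mulrnAl ler_wpM2r// mulr_natl lerDl ler01.
Qed.

(** * Coordinates adapted to the holonomy *)

(** The columns of [W] are lattice vectors and eigenvectors of the linear parts,
    and the point of coordinates [y] is [W *m y]. *)
Section Coordinates.
Variables (R : realType) (n : nat) (Gamma : groupClosed (motion R n)).
Local Notation G := (subgroup_of Gamma).
Local Notation V := 'cV[R]_n.
Implicit Types g h : G.
Hypothesis lin_sq : forall g, lin g *m lin g = 1%:M.
Variable W : 'M[R]_n.
Hypothesis W_unit : W \in unitmx.
Hypothesis W_lattice : forall k, translation_vector Gamma (col k W).
Hypothesis W_eigen : forall g k,
  lin g *m col k W = col k W \/ lin g *m col k W = - col k W.

Definition sgn g k : R := if lin g *m col k W == col k W then 1 else -1.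
Definition tra g : V := invmx W *m trans g.
Local Notation deck g := (diag_map (sgn g) (tra g)).

Lemma sgn_pm1 g k : sgn g k = 1 \/ sgn g k = -1.
Proof. by rewrite /sgn; case: ifP; [left|right]. Qed.

Lemma mulW_inj (y y' : V) : W *m y = W *m y' -> y = y'.
Proof. by move=> /(congr1 (mulmx (invmx W))); rewrite !mulKmx. Qed.

Lemma col_mulmx m k p (B : 'M[R]_(m, k)) (D : 'M[R]_(k, p)) i :
  col i (B *m D) = B *m col i D.
Proof. by apply/colP => j; rewrite !mxE; apply: eq_bigr => l _; rewrite mxE. Qed.

Lemma lin_mulW g y : lin g *m (W *m y) = W *m \col_k (sgn g k * y k 0).
Proof.
rewrite mulmxA; have -> : lin g *m W = W *m diag_mx (\row_k sgn g k).
  apply/matrixP => i k; rewrite mul_mx_diag !mxE.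
  have : lin g *m col k W = sgn g k *: col k W.
    rewrite /sgn; case: eqP => [->|ne]; first by rewrite scale1r.
    by case: (W_eigen g k) => // ->; rewrite scaleN1r.
  by rewrite -col_mulmx => /colP/(_ i); rewrite !mxE mulrC.
rewrite -mulmxA; congr (_ *m _); apply/colP => k.
by rewrite mul_diag_mx !mxE.
Qed.

Lemma act_mulW g y : act (val g) (W *m y) = W *m deck g y.
Proof.
rewrite /act -/(lin g) -/(trans g) lin_mulW /= /mkcts /diag_fun mulmxDr.
by rewrite /tra mulKVmx.
Qed.

Lemma deckM g h y : deck (g * h)%g y = deck g (deck h y).
Proof. by apply: mulW_inj; rewrite -!act_mulW -actM. Qed.

Lemma deck1 y : deck (1%g : G) y = y.
Proof. by apply: mulW_inj; rewrite -act_mulW act1. Qed.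

Lemma deck_lattice x : translation_vector Gamma (W *m x) ->
  exists g, forall y, deck g y = y + x.
Proof.
move=> [g [g1 gx]]; exists g => y; apply: mulW_inj; rewrite -act_mulW /act.
by rewrite -/(lin g) -/(trans g) g1 gx mul1mx mulmxDr.
Qed.

Lemma mulW_basis k : W *m basis_vector k = col k W.
Proof. by rewrite -colE. Qed.

Lemma deck_basis k : exists g, forall y, deck g y = y + basis_vector k.
Proof. by apply: deck_lattice; rewrite mulW_basis. Qed.

Lemma translation_vector_lattice u :
  lattice_vector finset.setT u -> translation_vector Gamma (W *m u).
Proof.
have vecn x m : translation_vector Gamma x -> translation_vector Gamma (x *+ m).
  move=> xL; elim: m => [|m IH]; first exact: translation_vector0.
  by rewrite mulrS; exact: translation_vectorD.
have vecz x (m : int) : translation_vector Gamma x -> translation_vector Gamma (x *~ m).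
  case: m => m xL; first exact: vecn.
  by rewrite NegzE mulrNz; apply: translation_vectorN; exact: vecn.
move=> uT; have -> : W *m u = \sum_k u k 0 *: col k W.
  apply/colP => i; rewrite mxE summxE; apply: eq_bigr => k _.
  by rewrite !mxE mulrC.
elim/big_rec: _ => [|k x _ xL]; first exact: translation_vector0.
apply: translation_vectorD => //; have [/intrP[m ->] _] := uT k.
by rewrite scaler_int; exact: vecz.
Qed.

Lemma orbit_map_continuous :
  continuous (fun y : V => \pi_(orbit_space Gamma) (W *m y) : orbit_space Gamma).
Proof.
move=> y.
apply: (@continuous_comp _ _ _ (fun y : V => W *m y)
  (\pi_(orbit_space Gamma) : V -> orbit_space Gamma)).
  exact: mulmx_continuous.
exact: pi_continuous.
Qed.

Definition orbit_map : continuousType V (orbit_space Gamma) :=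
  mkcts orbit_map_continuous.
Local Notation q := orbit_map.

Lemma eq_orbitP (x x' : V) :
  \pi_(orbit_space Gamma) x = \pi_(orbit_space Gamma) x' <->
  exists g, act (val g) x = x'.
Proof.
rewrite -[_ = _ <-> _]/(\pi_({eq_quot (same_orbit Gamma)}) x =
   \pi_({eq_quot (same_orbit Gamma)}) x' <-> _).
have E : (\pi_({eq_quot (same_orbit Gamma)}) x ==
    \pi_({eq_quot (same_orbit Gamma)}) x') = same_orbit Gamma x x' by rewrite piE.
split=> [/eqP|[g gx]].
  by rewrite E => /asboolP[g gG gx]; exists (SubgroupOf gG).
by apply/eqP; rewrite E; apply/asboolP; exists (val g) => //; exact: valP.
Qed.

Lemma orbit_map_deck y y' : q y = q y' <-> exists g, y' = deck g y.
Proof.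
split=> [/eq_orbitP[g gy]|[g gy]].
  by exists g; apply: mulW_inj; rewrite -act_mulW gy.
by apply/eq_orbitP; exists g; rewrite act_mulW gy.
Qed.

Lemma orbit_map_surj p : exists y, q y = p.
Proof.
exists (invmx W *m repr p); rewrite /= /mkcts mulKVmx//.
exact: (reprK (p : {eq_quot (same_orbit Gamma)})).
Qed.

Lemma orbit_map_open (U : set V) : open U -> open (q @` U).
Proof.
move=> oU; rewrite /open /= /quotient_open.
have -> : \pi_(orbit_space Gamma) @^-1` (q @` U) =
    \bigcup_(g in [set: G]) (fun x : V => invmx W *m lin g *m x + tra g) @^-1` U.
  apply/seteqP; split=> [x [y Uy]|x [g _ Ux]] /=.
    move=> /esym/eq_orbitP[g gx]; exists g => //=.
    rewrite -mulmxA /tra -mulmxDr -[_ + _]/(act (val g) x) gx mulKmx//.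
  exists (invmx W *m act (val g) x).
    by move: Ux; rewrite /= -mulmxA /tra -mulmxDr.
  by apply/esym/eq_orbitP; exists g; rewrite mulKVmx.
apply: bigcup_open => g _; apply: open_comp => // x _.
apply: continuousD; last exact: cst_continuous.
exact: mulmx_continuous.
Qed.

Variable r0 : R.
Hypothesis r0_gt0 : 0 < r0.
Hypothesis lattice_gap : forall x, translation_vector Gamma x -> `|x| < r0 -> x = 0.

Lemma coordinate_gap : exists2 r1 : R, 0 < r1 &
  forall u : V, translation_vector Gamma (W *m u) -> `|u| < r1 -> u = 0.
Proof.
have [C C0 WC] := mulmx_norm_le W; exists (r0 / C); first exact: divr_gt0.
move=> u uL ur; apply: mulW_inj; rewrite mulmx0; apply: lattice_gap => //.
by apply: le_lt_trans (WC u) _; rewrite mulrC -ltr_pdivlMr.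
Qed.

(** If [g] moves [y] by less than half the gap of the lattice, then [g * g], a
    translation since linear parts are involutions, is too short to be nonzero.
    So [g * g = 1], and [g = 1] by torsion-freeness. *)
Lemma orbit_map_gap : torsion_free Gamma -> exists2 r : R, 0 < r &
  forall y y', q y = q y' -> y = y' \/ r <= `|y - y'|.
Proof.
move=> tf; have [r1 r10 r1P] := coordinate_gap.
exists (r1 / 2) => [|y y' /orbit_map_deck[g ->]]; first by rewrite divr_gt0.
have [] := leP (r1 / 2) `|y - deck g y|; first by right.
move=> yr; left.
pose u := tra (g * g)%g.
have uE z : deck (g * g)%g z = z + u.
  apply/colP => k; rewrite /= /mkcts /diag_fun !mxE /sgn.
  by rewrite linM lin_sq mul1mx eqxx mul1r.
have uL : translation_vector Gamma (W *m u).
  exists (g * g)%g; rewrite linM lin_sq; split=> //.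
  by rewrite /u /tra mulKVmx.
have u0 : u = 0.
  apply: r1P => //.
  have -> : u = (deck g (deck g y) - deck g y) + (deck g y - y).
    by rewrite addrA subrK -deckM uE addrC addKr.
  apply: le_lt_trans (ler_normD _ _) _.
  rewrite (deck_isometry (fun g => tra g) sgn_pm1) (distrC _ y); lra.
have /(congr1 val) gg : (g * g = 1)%g.
  apply: subgroup_eq; first by rewrite linM lin_sq.
  apply: (can_inj (mulKmx (_ : invmx W \in unitmx))); rewrite ?unitmx_inv//.
  by rewrite -/(tra _) -/u u0 trans1 mulmx0.
have g1 : g = 1%g.
  apply: val_inj; apply: (tf _ 2) => //; first exact: valP.
by rewrite g1 deck1.
Qed.

(** The lattice spanned by the columns of [W] has finite index in [Gamma]: two
    elements with the same signs whose translation parts have fractional parts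
    in the same small box differ by a translation close to an integral vector,
    hence equal to it. *)
Section Boxes.
Variables (r1 : R) (N : nat).
Hypothesis r1P : forall u : V,
  translation_vector Gamma (W *m u) -> `|u| < r1 -> u = 0.
Hypothesis N_r1 : N.+1%:R^-1 < r1.

Definition frac (x : R) : R := x - (Num.floor x)%:~R.

Definition box g :
    ({ffun 'I_n -> bool} * {ffun 'I_n -> 'I_N.+1})%type :=
  ([ffun k => sgn g k == 1],
   [ffun k => inord (Num.truncn (N.+1%:R * frac (tra g k 0)))]).

Lemma frac_itv x : 0 <= frac x < 1.
Proof.
have /andP[x0 x1] := floor_itv x.
by rewrite /frac subr_ge0 x0 ltrBlDr addrC -[X in _ < _ + X]/(1%:~R) -intrD.
Qed.

Lemma box_frac x x' :
  inord (Num.truncn (N.+1%:R * frac x)) =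
  inord (Num.truncn (N.+1%:R * frac x')) :> 'I_N.+1 ->
  `|frac x - frac x'| < r1.
Proof.
have NP : (0 : R) < N.+1%:R by rewrite ltr0n.
have B y : (Num.truncn (N.+1%:R * frac y) < N.+1)%N.
  have /andP[y0 y1] := frac_itv y.
  rewrite -(ltr_nat R); apply: (@le_lt_trans _ _ (N.+1%:R * frac y)).
    by rewrite truncn_le// mulr_ge0.
  by rewrite gtr_pMr.
move=> /(congr1 val); rewrite /= !inordK// => E.
have T y : (Num.truncn (N.+1%:R * frac y))%:R <= N.+1%:R * frac y <
    (Num.truncn (N.+1%:R * frac y)).+1%:R.
  by apply: truncn_itv; rewrite mulr_ge0//; have /andP[] := frac_itv y.
have /andP[a1 a2] := T x; have /andP[b1 b2] := T x'.
rewrite E in a1 a2; apply: lt_trans N_r1.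
rewrite -[X in _ < X]mulr1 ltr_pdivlMl// -[X in X * _](@gtr0_norm R)// -normrM.
rewrite mulrBr ltr_norml; rewrite -[(Num.truncn _).+1%:R]natr1 in a2;
  rewrite -[(Num.truncn _).+1%:R]natr1 in b2; apply/andP; split; lra.
Qed.

Lemma sgn_lin g h : sgn g =1 sgn h -> lin g = lin h.
Proof.
move=> gh; apply: (can_inj (mulmxK W_unit)); apply/matrixP => i k.
have E g' : (lin g' *m W) i k = (W *m \col_l (sgn g' l * basis_vector k l 0)) i 0.
  by rewrite -lin_mulW mulW_basis -col_mulmx [RHS]mxE.
rewrite !E; congr (fun_of_matrix (_ *m _) _ _).
by apply/colP => l; rewrite !mxE gh.
Qed.

(** Rewriting with [mxE] would also unfold the value of [diag_map]; this lemma
    and the next two compute only the outermost operation. *)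
Lemma entryD (a b : V) k : (a + b) k 0 = a k 0 + b k 0.
Proof. by rewrite mxE. Qed.

Lemma entry0 k : (0 : V) k 0 = 0.
Proof. by rewrite mxE. Qed.

Lemma deckE g y k : deck g y k 0 = sgn g k * y k 0 + tra g k 0.
Proof. by rewrite /= /mkcts /diag_fun; move: (tra g) => t; rewrite !mxE. Qed.

Lemma boxP g h : box g = box h <->
  exists2 u, lattice_vector finset.setT u & forall y, deck h y = deck g y + u.
Proof.
split=> [[/ffunP sE /ffunP tE]|[u uT gh]].
  have sgh : sgn g =1 sgn h.
    move=> k; have := sE k; rewrite !ffunE.
    have [->|->] := sgn_pm1 g k; have [->|->] := sgn_pm1 h k => //.
      by rewrite eqxx => /esym/eqP.
    by rewrite eqxx => /eqP.
  have lgh := sgn_lin sgh.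
  pose m : V := \col_k ((Num.floor (tra h k 0))%:~R - (Num.floor (tra g k 0))%:~R).
  have mT : lattice_vector finset.setT m.
    by move=> k; rewrite mxE inE; split=> //; rewrite rpredB ?intr_int.
  have mE k : m k 0 = (Num.floor (tra h k 0))%:~R - (Num.floor (tra g k 0))%:~R.
    by rewrite mxE.
  have dE k : (tra h - tra g - m) k 0 = tra h k 0 - tra g k 0 - m k 0.
    by move: (tra h) (tra g) (m) => a b c; rewrite !mxE.
  have E : tra h - tra g - m = 0.
    apply: r1P.
      rewrite mulmxBr; apply: translation_vectorD; last first.
        exact/translation_vectorN/translation_vector_lattice.
      rewrite /tra -mulmxBr mulKVmx//; exact: translation_vector_sub.
    apply/mx_norm_ltP; first by apply: lt_trans N_r1; rewrite invr_gt0 ltr0n.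
    move=> k i; rewrite ord1 dE mE distrC.
    have := tE k; rewrite !ffunE => /box_frac; rewrite /frac.
    by congr (`|_| < _); ring.
  exists m => // y; apply/colP => k.
  have := congr1 (fun A : V => A k 0) E.
  rewrite dE entry0 => Ek.
  rewrite [RHS]entryD !deckE sgh -addrA; congr (_ + _).
  by apply/eqP; rewrite -subr_eq0 opprD addrA Ek.
have tE k : tra h k 0 = tra g k 0 + u k 0.
  have := congr1 (fun A : V => A k 0) (gh 0).
  by rewrite [X in _ = X -> _]entryD !deckE entry0 !mulr0 !add0r.
have sE k : sgn h k = sgn g k.
  have := congr1 (fun A : V => A k 0) (gh (basis_vector k)).
  rewrite [X in _ = X -> _]entryD !deckE.
  have -> : basis_vector k k 0 = 1 :> R by rewrite mxE !eqxx.
  by rewrite !mulr1 tE -addrA => /addIr.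
congr pair; apply/ffunP => k; rewrite !ffunE ?sE//; congr (inord (Num.truncn (_ * _))).
have [uZ _] := uT k; rewrite tE /frac floorDrz// intrD (floorK uZ).
by rewrite opprD addrACA subrr addr0.
Qed.

End Boxes.

End Coordinates.

(** * The group of signs *)

Section SignVectors.
Variable n : nat.
Implicit Types a b : {ffun 'I_n -> bool}.

Definition xorf a b : {ffun 'I_n -> bool} := [ffun k => a k (+) b k].

Lemma xorfK a : involutive (xorf a).
Proof. by move=> b; apply/ffunP => k; rewrite !ffunE addKb. Qed.

Lemma xorfKr a b : xorf (xorf a b) b = a.
Proof. by apply/ffunP => k; rewrite !ffunE addbK. Qed.

(** The complement of a subgroup of index two is a single coset. *)
Lemma index_two (H : {set {ffun 'I_n -> bool}}) : (0 < n)%N ->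
  #|H| = (2 ^ n.-1)%N -> {in H &, forall a b, xorf a b \in H} ->
  forall a b, a \notin H -> b \notin H -> xorf a b \in H.
Proof.
move=> n0 cH Hx a b aH bH; pose aH' := (xorf a @: H)%SET.
have dis : (H :&: aH')%SET = finset.set0.
  apply/finset.setP => c; rewrite !inE; apply/negP => /andP[cH' /imsetP[h hH ch]].
  by move/negP: aH; apply; rewrite -(xorfKr a h) -ch Hx.
have ca : #|aH'| = #|H| by rewrite card_imset//; exact: can_inj (xorfK a).
have HT : (H :|: aH')%SET = finset.setT.
  apply/eqP; rewrite eqEcard finset.subsetT /= cardsT card_ffun card_bool card_ord.
  by rewrite cardsU dis cards0 subn0 ca cH addnn -mul2n -expnS prednK.
have : b \in (H :|: aH')%SET by rewrite HT inE.
by rewrite inE (negbTE bH) /= => /imsetP[h hH ->]; rewrite xorfK.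
Qed.

End SignVectors.

Lemma augmentation_boundary (K : nzRingType) (R : realType) (X : topologicalType)
    (c : chain K R X 1) : augmentation K R X (boundary K R X 1 c) = 0.
Proof.
elim/chain_ind: c => [|a s c IH]; first by rewrite !linear0.
rewrite !linearP IH addr0 boundaryU big_ord_recl big_ord1 linearD !linearZ.
by rewrite /= !augmentationU expr0 expr1 scale1r scaleN1r subrr scaler0.
Qed.

Section SignGroup.
Variables (R : realType) (n : nat) (Gamma : groupClosed (motion R n)).
Local Notation G := (subgroup_of Gamma).
Local Notation V := 'cV[R]_n.
Implicit Types g h : G.
Variable f : holonomy_group Gamma -> 'rV['F_2]_n.-1.
Hypothesis f_bij : bijective f.
Hypothesis fM : forall x y, f (x * y)%g = f x + f y.
Variable W : 'M[R]_n.
Hypothesis W_unit : W \in unitmx.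
Hypothesis W_eigen : forall g k,
  lin g *m col k W = col k W \/ lin g *m col k W = - col k W.

Lemma sgnM g h k : sgn W (g * h)%g k = sgn W g k * sgn W h k.
Proof.
have E := lin_mulW W_eigen.
have : W *m \col_i (sgn W (g * h)%g i * basis_vector k i 0) =
    W *m \col_i (sgn W g i * (\col_l (sgn W h l * basis_vector k l 0) : V) i 0).
  by rewrite -!E linM -mulmxA.
move=> /(mulW_inj W_unit)/colP/(_ k); rewrite !mxE !eqxx.
by rewrite !mulr1.
Qed.

(** Signs as booleans, [true] for -1, so that they live in a finite type. *)
Definition sign_bits g : {ffun 'I_n -> bool} := [ffun k => sgn W g k == -1].

Lemma sgn_sign_bits g k : sgn W g k = if sign_bits g k then -1 else 1.
Proof.
rewrite ffunE; have [->|->] := sgn_pm1 W g k; last by rewrite eqxx.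
by rewrite eq_sym eqNr oner_eq0.
Qed.

Definition sign_group : {set {ffun 'I_n -> bool}} :=
  [set t | `[< exists g, sign_bits g = t >]]%SET.

Lemma sign_groupP t : reflect (exists g, sign_bits g = t) (t \in sign_group).
Proof. by rewrite inE; exact: asboolP. Qed.

Lemma sign_group_xor : {in sign_group &, forall a b, xorf a b \in sign_group}.
Proof.
move=> _ _ /sign_groupP[g <-] /sign_groupP[h <-]; apply/sign_groupP.
exists (g * h)%g; apply/ffunP => k; rewrite !ffunE sgnM.
have [->|->] := sgn_pm1 W g k; have [->|->] := sgn_pm1 W h k;
  by rewrite ?mul1r ?mulN1r ?opprK ?eqxx ?(eq_sym 1) ?eqNr ?oner_eq0.
Qed.

(** The signs of [g] determine its linear part, hence its holonomy. *)
Lemma card_sign_group : #|sign_group| = (2 ^ n.-1)%N.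
Proof.
pose psi v := sign_bits (holonomy_rep f_bij v).
have psi_inj : injective psi.
  move=> v v' /ffunP E; rewrite -(holonomy_repK f_bij v) -(holonomy_repK f_bij v').
  apply/(holonomy_lin f_bij)/(sgn_lin W_unit W_eigen) => k.
  by rewrite !sgn_sign_bits; have := E k; rewrite /psi => ->.
have -> : sign_group = (psi @: finset.setT)%SET.
  apply/finset.setP => t; apply/sign_groupP/imsetP => [[g <-]|[v _ ->]]; last first.
    by exists (holonomy_rep f_bij v).
  exists (holonomy f g); rewrite ?inE//; apply/ffunP => k; rewrite !ffunE /sgn.
  have /(holonomy_lin f_bij)-> // :
      holonomy f (holonomy_rep f_bij (holonomy f g)) = holonomy f g.
  exact: holonomy_repK.
rewrite card_imset// cardsT card_mx mul1n.
by rewrite (_ : #|'F_2| = 2)// card_Fp.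
Qed.

(** The signs of the reflection of the k-th coordinate. *)
Definition single (k : 'I_n) : {ffun 'I_n -> bool} := [ffun i => i == k].

(** If the first alternative fails, every missing reflection [k] is accompanied
    by another missing one [l], and their product is in the group because it
    has index two. *)
Lemma sign_group_dichotomy : (0 < n)%N ->
  (exists i, forall k, k != i -> single k \in sign_group) \/
  (forall k, single k \notin sign_group ->
     exists2 l, l != k & xorf (single k) (single l) \in sign_group).
Proof.
move=> n0; have Hx := index_two n0 card_sign_group sign_group_xor.
have [ex|nex] := pselect (exists i, forall k, k != i -> single k \in sign_group).
  by left.
right=> k kH; apply: contrapT => nl; apply: nex; exists k => l lk.
apply: contrapT => /negP lH; apply: nl; exists l => //; exact: Hx.
Qed.

End SignGroup.

Section Flips.
Variables (R : realType) (n : nat).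
Local Notation V := 'cV[R]_n.
Local Notation N := (null (finset.setT : {set 'I_n})).

Lemma dpush_flip2 k l j (w : chain rat R V j) : l != k ->
  dpush (flip R k) 0 (dpush (flip R l) 0 w) =
  dpush (fun i => if xorf (single k) (single l) i then -1 else 1) 0 w.
Proof.
move=> lk; rewrite dpush_comp; apply: eq_dpush => [i|]; last first.
  by apply/colP => i; rewrite !mxE mulr0 addr0.
rewrite !ffunE /flip; case: (eqVneq i k) => [->|_] /=.
  by rewrite eq_sym (negbTE lk) mulr1.
by rewrite mul1r.
Qed.

End Flips.

(** * Homology of generalized Hantzsche-Wendt manifolds *)

Theorem theorem4p2 (R : realType) (n : nat)
    (Gamma : groupClosed (motion R n)) :
  generalized_hantzsche_wendt Gamma ->
  has_betti_number R (orbit_space Gamma) 1 1 ->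
  forall j : nat,
    (j = 0%N \/ j = 1%N ->
       lmod_iso (singular_homology rat R (orbit_space Gamma) j) rat^o) /\
    (j <> 0%N -> j <> 1%N ->
       forall h : singular_homology rat R (orbit_space Gamma) j, h = 0).
Proof.
move=> [n0 [tf disc coc] [f [f_bij fM]]] betti1.
have lsq := lin_sq f_bij fM.
have [W [Wu We]] := basis_from_spanning
  (fun l => @eigen_lattice_functional_eq0 _ _ _ _ f_bij fM l coc).
have Wl k : translation_vector Gamma (col k W) by have [] := We k.
have Weig (g : subgroup_of Gamma) k :
    lin g *m col k W = col k W \/ lin g *m col k W = - col k W.
  by have [_] := We k; apply.
have [r0 r0_gt0 lattice_gap] := discrete_lattice_gap disc.
have [r1 r1_gt0 r1P] := coordinate_gap Wu r0_gt0 lattice_gap.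
have [r r_gt0 q_gap] := orbit_map_gap lsq Wu Weig r0_gt0 lattice_gap tf.
have [N Nr1] : exists N, (N.+1%:R : R)^-1 < r1.
  have : 0 <= r1^-1 by rewrite invr_ge0 ltW.
  move=> /archi_boundP; set N := Num.bound _ => r1N; exists N.
  rewrite invf_plt ?posrE ?ltr0n// (lt_trans r1N)// ltr_nat.
  exact: leqnn.
have q_open := orbit_map_open (Gamma := Gamma) Wu.
have q_surj := @orbit_map_surj _ _ Gamma _ Wu.
have q_deck := orbit_map_deck Wu Weig.
have bounds j := @boundary_of_null _ _ _ (orbit_map Gamma W) r r_gt0 q_open q_surj
  q_gap _ _ _ (@sgn_pm1 _ _ Gamma W) (deckM Wu Weig) (deck1 Wu Weig) q_deck
  (deck_basis Wu Wl Weig) _ _ (boxP Wu Wl Weig r1P Nr1) j.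
(* the functions [sgn W g] and [d] are only pointwise equal *)
have flipP (g : subgroup_of Gamma) (d : 'I_n -> R) j (w : chain rat R 'cV[R]_n j) :
    (forall k, sgn W g k = d k) ->
    (forall h : subgroup_of Gamma,
      null finset.setT (w - dpush (sgn W h) 0 w)) ->
    null finset.setT (w - dpush d 0 w).
  by move=> /funext E H; rewrite -E; exact: (H g).
have single_sgn (g : subgroup_of Gamma) k : sign_bits W g = single k ->
    forall i, sgn W g i = flip R k i.
  by move=> gk i; rewrite sgn_sign_bits gk ffunE.
have H0 : lmod_iso (singular_homology rat R (orbit_space Gamma) 0) rat^o.
  apply: (homology_iso (a := augmentation rat R (orbit_space Gamma))).
  - exact: augmentation_boundary.
  - move=> z _; exact: (boundary_of_augmentation0 r_gt0 q_open q_surj q_gap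
      (@sgn_pm1 _ _ Gamma W) q_deck).
  - exists (gen (const_simplex R (orbit_map Gamma W 0) 0)) => //.
    exact: augmentationU.
have H1 : lmod_iso (singular_homology rat R (orbit_space Gamma) 1) rat^o.
  exact: lmod_iso_trans betti1 (rV1_iso _).
have Hge2 j (h : singular_homology rat R (orbit_space Gamma) j.+2) : h = 0.
  apply: homology_eq0 => z z0; apply: (bounds _ z z0) => w wZ wsgn.
  have [[i si]|sk] := sign_group_dichotomy f_bij Wu Weig n0.
    apply: (null_of_flips wZ (i := i)) => k /si/sign_groupP[g gk].
    exact: flipP (single_sgn _ _ gk) _.
  (* in this case the first homology would vanish *)
  exfalso; apply: (rV1_neq0 betti1) => {}h.
  apply: homology_eq0 => {}z {}z0; apply: (bounds _ z z0) => {w wZ wsgn} w wZ wsgn.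
  apply: (null1_of_flips (S := [set k | single k \notin sign_group Gamma W]%SET) wZ).
    move=> k; rewrite inE negbK => /sign_groupP[g gk].
    exact: flipP (single_sgn _ _ gk) _.
  move=> k; rewrite inE => /sk[l lk /sign_groupP[g gkl]]; exists l => //.
  rewrite dpush_flip2//; apply: (flipP g) => // i.
  by rewrite sgn_sign_bits gkl.
move=> [|[|j]]; split=> //; try by move=> [].
Qed.
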